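(* In the setting and with the notation of the context, assume $\sum_{i=1}^N\mu_i<\infty$. Then the three quantities $$\inf\{D(f)/\mu(f^2):f\ne0,\,D(f)<\infty\},\quad \inf\{D(f):\mu(f^2)=1\},\quad \inf\{D(f):\mu(f^2)=1,\ \exists m\in E\ \forall i\in E:\ f_i=f_{i\wedge m}\}$$ coincide, and for their common value $\lambda_0$ the following variational formulas hold. (1) Difference form: $\displaystyle\inf_{v\in\widetilde{\mathscr V}_1}\sup_{i\in E}\widetilde R_i(v)=\lambda_0=\sup_{v\in\mathscr V_1}\inf_{i\in E}R_i(v).$ (2) Single summation form: $\displaystyle\inf_{f\in\widetilde{\mathscr F}_I}\sup_{i\in E}I_i(f)^{-1}=\lambda_0=\sup_{f\in\mathscr F_I}\inf_{i\in E}I_i(f)^{-1}.$ (3) Double summation form: $$\lambda_0=\sup_{f\in\mathscr F_{II}}\inf_{i\in E}II_i(f)^{-1}=\sup_{f\in\mathscr F_I}\inf_{i\in E}II_i(f)^{-1},$$ $$\lambda_0=\inf_{f\in\widetilde{\mathscr F}_I}\sup_{i\in E}II_i(f)^{-1}=\inf_{f\in\widetilde{\mathscr F}_{II}}\sup_{i\in E}II_i(f)^{-1}=\inf_{f\in\widetilde{\mathscr F}_{II}\cup\widetilde{\mathscr F}_{II}'}\sup_{i\in E}II_i(f)^{-1}.$$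
   Context: Setting. $E=\{i\in\mathbb Z:1\le i<N+1\}$, $1\le N\le\infty$; death rates $a_i>0$ for all $i\in E$ ($a_1$ is a killing rate at $1$, i.e. Dirichlet boundary at $0$); birth rates $b_i>0$ for $1\le i<N$, and $b_N=0$ if $N<\infty$. $\mu_1=1$, $\mu_k=\frac{b_1\cdots b_{k-1}}{a_2\cdots a_k}$ for $2\le k<N+1$; $\mu(f)=\sum_{k\in E}\mu_kf_k$; $D(f)=\sum_{k\in E}\mu_ka_k(f_k-f_{k-1})^2$ with $f_0:=0$. Operators (conventions $1/0=\infty$, $1/\infty=0$, $f_0:=0$): - $I_i(f)=\frac1{\mu_ia_i(f_i-f_{i-1})}\sum_{j=i}^N\mu_jf_j$; - $II_i(f)=\frac1{f_i}\sum_{j=1}^i\frac1{\mu_ja_j}\sum_{k=j}^N\mu_kf_k$; - $R_i(v)=a_i(1-v_{i-1}^{-1})+b_i(1-v_i)$, $i\in E$, with $v_0:=\infty$ (if $N<\infty$, $v_N$ is irrelevant since $b_N=0$). - For $v\in\widetilde{\mathscr V}_1$ (below) with associated $m$, $\widetilde R_i(v)$ is $R_i(v)$ with $a_m$ replaced by $\tilde a_m=\mu_ma_m\big/\sum_{k=m}^N\mu_k$ (other $a_i$ unchanged). Sets: - $\mathscr F_{II}=\{f:f_i>0\ \forall i\in E\}$; $\mathscr F_I=\{f:f>0\text{ and strictly increasing on }E\}$; $\mathscr V_1=\{v:v_i>1\ \forall i\in E\}$. - $\widetilde{\mathscr F}_{II}=\{f:\exists m\in E\text{ with }f_i=f_{i\wedge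 m}>0\ \forall i\in E\}$; - $\widetilde{\mathscr F}_I=\{f:\exists m\in E\text{ with }f_i=f_{i\wedge m}>0\ \forall i\in E\text{ and }f\text{ strictly increasing on }\{1,\dots,m\}\}$; - $\widetilde{\mathscr F}_{II}'=\{f:f_i>0\ \forall i\in E\text{ and }fII(f)\in L^2(\mu)\}$, where $fII(f)$ denotes $i\mapsto f_iII_i(f)$; - $\widetilde{\mathscr V}_1=\bigcup_{m\in E}\{v:\ 1<v_i<1+a_i(1-v_{i-1}^{-1})b_i^{-1}\text{ for }i=1,\dots,m-1,\ v_i=1\text{ for }i\ge m\}$. *)

(* Defs.v *)
From HB Require Import structures.
From mathcomp Require Import all_boot all_order all_algebra.
From mathcomp Require Import all_classical all_reals all_analysis.

Set Implicit Arguments.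
Unset Strict Implicit.
Unset Printing Implicit Defensive.

Import Order.TTheory GRing.Theory Num.Theory.

Local Open Scope classical_set_scope.
Local Open Scope ring_scope.

(* N : option nat encodes 1 <= N <= oo, with None for N = oo. *)
Definition below (N : option nat) (i : nat) : bool :=
  if N is Some n then (i < n)%N else true.

Definition in_states (N : option nat) (i : nat) : bool :=
  (0 < i)%N && (if N is Some n then (i <= n)%N else true).

Definition states (N : option nat) : set nat := [set i | in_states N i].

(* Functions on E are represented by functions on nat whose values outside E
   are never read; [ext0 f] is f with f_0 := 0.  The convention v_0 := oo is
   expressed by applying [ext0] to i |-> v_i^-1. *)
Definition ext0 (R : realType) (f : nat -> R) (i : nat) : R :=
  if i is 0%N then 0 else f i.

Definition mu (R : realType) (a b : nat -> R) (k : nat) : R :=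
  (\prod_(1 <= j < k) b j) / (\prod_(2 <= j < k.+1) a j).

Section Functionals.
Local Open Scope ereal_scope.

Definition mu_sum (R : realType) (N : option nat) (a b : nat -> R)
    (F : nat -> \bar R) : \bar R :=
  \sum_(1 <= k <oo | in_states N k) (mu a b k)%:E * F k.

Definition mu_sq (R : realType) (N : option nat) (a b f : nat -> R) : \bar R :=
  mu_sum N a b (fun k => (f k ^+ 2)%R%:E).

Definition mu_tail (R : realType) (N : option nat) (a b f : nat -> R)
    (i : nat) : \bar R :=
  \sum_(i <= j <oo | in_states N j) (mu a b j * f j)%R%:E.

Definition Dform (R : realType) (N : option nat) (a b f : nat -> R) : \bar R :=
  \sum_(1 <= k <oo | in_states N k)
    (mu a b k * a k * (f k - ext0 f k.-1) ^+ 2)%R%:E.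

(* The inverse on \bar R satisfies 0^-1 = +oo and +oo^-1 = 0. *)
Definition Iop (R : realType) (N : option nat) (a b f : nat -> R)
    (i : nat) : \bar R :=
  ((mu a b i * a i * (f i - ext0 f i.-1))%R%:E)^-1 * mu_tail N a b f i.

Definition IIop (R : realType) (N : option nat) (a b f : nat -> R)
    (i : nat) : \bar R :=
  ((f i)%:E)^-1 *
  \sum_(1 <= j < i.+1) ((mu a b j * a j)%R%:E)^-1 * mu_tail N a b f j.

End Functionals.

Definition Rop (R : realType) (a b v : nat -> R) (i : nat) : R :=
  a i * (1 - ext0 (fun j => (v j)^-1) i.-1) + b i * (1 - v i).

(* The tail sum is finite whenever mu is summable, hence the use of [fine]. *)
Definition tilde_a (R : realType) (N : option nat) (a b : nat -> R)
    (m i : nat) : R :=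
  if i == m then mu a b m * a m / fine (mu_tail N a b (fun=> 1) m) else a i.

Definition tildeRop (R : realType) (N : option nat) (a b : nat -> R) (m : nat)
    (v : nat -> R) (i : nat) : R :=
  Rop (tilde_a N a b m) b v i.

Definition stopped_at (R : realType) (N : option nat) (m : nat)
    (f : nat -> R) : Prop :=
  forall i, in_states N i -> f i = f (minn i m).

Definition positive_on (R : realType) (N : option nat) (f : nat -> R) : Prop :=
  forall i, in_states N i -> 0 < f i.

Definition F_II (R : realType) (N : option nat) : set (nat -> R) :=
  [set f | positive_on N f].

Definition F_I (R : realType) (N : option nat) : set (nat -> R) :=
  [set f | positive_on N f /\
    forall i j, in_states N i -> in_states N j -> (i < j)%N -> f i < f j].

Definition V_1 (R : realType) (N : option nat) : set (nat -> R) :=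
  [set v | forall i, in_states N i -> 1 < v i].

Definition tF_II (R : realType) (N : option nat) : set (nat -> R) :=
  [set f | exists m, [/\ in_states N m, stopped_at N m f & positive_on N f]].

Definition tF_I (R : realType) (N : option nat) : set (nat -> R) :=
  [set f | exists m, [/\ in_states N m, stopped_at N m f, positive_on N f &
    forall i j, (0 < i)%N -> (i < j)%N -> (j <= m)%N -> f i < f j]].

Definition tF_II' (R : realType) (N : option nat) (a b : nat -> R) :
    set (nat -> R) :=
  [set f | positive_on N f /\
    (mu_sum N a b (fun i => ((f i)%:E * IIop N a b f i) ^+ 2) < +oo)%E].

(* The pairs (m, v) with v in the m-th set of the union defining
   \tilde V_1; such an m is determined by v on E, as v_i > 1 for i < m and
   v_m = 1. *)
Definition tV_1 (R : realType) (N : option nat) (a b : nat -> R) :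
    set (nat * (nat -> R)) :=
  [set p | let: (m, v) := p in
    [/\ in_states N m,
        (forall i, (0 < i)%N -> (i < m)%N ->
           1 < v i < 1 + a i * (1 - ext0 (fun j => (v j)^-1) i.-1) * (b i)^-1) &
        (forall i, in_states N i -> (m <= i)%N -> v i = 1)]].

Section Extrema.
Local Open Scope ereal_scope.

Definition infE (R : realType) (N : option nat) (F : nat -> \bar R) : \bar R :=
  ereal_inf [set F i | i in states N].

Definition supE (R : realType) (N : option nat) (F : nat -> \bar R) : \bar R :=
  ereal_sup [set F i | i in states N].

Definition lambda_ratio (R : realType) (N : option nat) (a b : nat -> R) :
    \bar R :=
  ereal_inf [set Dform N a b f / mu_sq N a b f | f in
    [set f : nat -> R |
      (exists i, in_states N i /\ f i != 0%R) /\ Dform N a b f < +oo]].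

Definition lambda_norm (R : realType) (N : option nat) (a b : nat -> R) :
    \bar R :=
  ereal_inf [set Dform N a b f | f in
    [set f : nat -> R | mu_sq N a b f = 1]].

Definition lambda_stopped (R : realType) (N : option nat) (a b : nat -> R) :
    \bar R :=
  ereal_inf [set Dform N a b f | f in
    [set f : nat -> R | mu_sq N a b f = 1 /\
      exists m, in_states N m /\ stopped_at N m f]].

End Extrema.

(* Main.v *)
(* Solve, from g_0 = 0 and g_1 = 1, the equation -Omega g = lam g; its flux
   W_k = mu_{k+1} a_{k+1} (g_{k+1} - g_k) satisfies W_{k+1} = W_k - lam mu_{k+1} g_{k+1}.
   Testing lambda_stopped with g stopped at n shows that, for lam <= lambda_stopped,
   W_n dominates lam g_n sum_{k > n} mu_k, so g is positive and increasing and
   v_i = g_{i+1} / g_i satisfies R_i(v) >= lam.  If lam > lambda_stopped, Picone's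
   inequality with g forces W_m <= lam g_m sum_{k > m} mu_k at some m; stopping v at
   the first such m gives an element of tV_1 with tilde R(v) <= lam.
   All other quantities are squeezed in between: writing h = f II(f), one gets
   lambda_ratio >= inf_i II_i(f)^-1 from Picone's inequality with h, and
   lambda_ratio <= sup_i II_i(f)^-1 by testing with h (stopped where f is); the forms
   R, I and II are compared by summing the difference inequality.  This gives
     lambda_stopped <= sup inf R <= sup inf I^-1 <= sup inf II^-1 <= lambda_ratio
       <= lambda_norm <= lambda_stopped
   and
     lambda_ratio <= inf sup II^-1 <= inf sup I^-1 <= inf sup tilde R
       <= lambda_stopped. *)

Require Import Defs.
From HB Require Import structures.
From mathcomp Require Import all_boot all_order all_algebra.
From mathcomp Require Import all_classical all_reals all_analysis.
From mathcomp Require Import ring lra.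

Set Implicit Arguments.
Unset Strict Implicit.
Unset Printing Implicit Defensive.

Import Order.TTheory GRing.Theory Num.Theory.

Local Open Scope classical_set_scope.
Local Open Scope ereal_scope.

(** * Comparing extended reals through positive real bounds *)

Section ExtendedReals.
Context {R : realType}.
Implicit Types (c w : R) (x y T : \bar R).

(** Reduces a comparison of infima of inverted operators to positive real bounds [c], for which the
    inverses can be cleared. If [x] is [+oo], then [y] exceeds every real. *)
Lemma lee_posP x y : 0 <= y ->
  (forall c, (0 < c)%R -> c%:E <= x -> c%:E <= y) -> x <= y.
Proof.
move=> y0 xy; have [x0|x0] := leP x 0; first exact: le_trans y0.
case: x x0 xy => [r||] //= x0 xy; first exact: xy.
case: y y0 xy => [s||] //= y0 xy; rewrite lee_fin in y0.
have s1 : (0 < s + 1)%R by rewrite ltr_wpDl.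
by have := xy _ s1 (leey _); rewrite lee_fin leNgt ltrDl ltr01.
Qed.

(** For finite [y], the bounds [c = y + e] with [e > 0] suffice; they stay positive even when [y] is
    0. *)
Lemma gee_posP x y : 0 <= y ->
  (forall c, (0 < c)%R -> y <= c%:E -> x <= c%:E) -> x <= y.
Proof.
case: y => [s||] //= y0 xy; last exact: leey.
apply/lee_addgt0Pr => e e0; rewrite -EFinD; apply: xy.
  by rewrite lee_fin in y0; rewrite ltr_wpDl.
by rewrite lee_fin lerDl ltW.
Qed.

(** Clears both inverses at once. The degenerate values agree: both sides fail for [T = +oo] and
    both hold for [T = 0]. *)
Lemma lee_inv_div c w T : (0 < c)%R -> (0 < w)%R -> 0 <= T ->
  (c%:E <= (w%:E^-1 * T)^-1) = (c%:E * T <= w%:E).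
Proof.
move=> c0 w0; have cN := gt_eqF c0; have wN := gt_eqF w0.
case: T => [t||] //= t0; last first.
  by rewrite inver wN gt0_muley ?lte_fin ?invr_gt0// gt0_muley ?lte_fin// invey
     lee_fin leNgt c0.
rewrite inve_pge ?inE; last first.
- by apply: mule_ge0 => //; rewrite inve_ge0 lee_fin ltW.
- by rewrite lee_fin ltW.
rewrite !inver wN cN -!EFinM !lee_fin mulrC ler_pdivrMr// -[(_ * w)%R]mulrC.
by rewrite ler_pdivlMr// mulrC.
Qed.

(** Here both sides hold for [T = +oo] and both fail for [T = 0]. *)
Lemma inv_div_lee c w T : (0 < c)%R -> (0 < w)%R -> 0 <= T ->
  ((w%:E^-1 * T)^-1 <= c%:E) = (w%:E <= c%:E * T).
Proof.
move=> c0 w0; have cN := gt_eqF c0; have wN := gt_eqF w0.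
case: T => [t||] //= t0; last first.
  by rewrite inver wN gt0_muley ?lte_fin ?invr_gt0// gt0_muley ?lte_fin// invey
     lee_fin leey ltW.
rewrite inve_ple ?inE; last first.
- by rewrite lee_fin ltW.
- by apply: mule_ge0 => //; rewrite inve_ge0 lee_fin ltW.
rewrite !inver wN cN -!EFinM !lee_fin ler_pdivlMl// ler_pdivrMr//.
by rewrite [(t * c)%R]mulrC.
Qed.

End ExtendedReals.

(** * Series over the states *)

Section StateSeries.
Context {R : realType} (N : option nat).
Implicit Types (u : nat -> R) (i n : nat).
Local Open Scope ring_scope.

Lemma below_le m n : (m <= n)%N -> below N n -> below N m.
Proof. by case: N => //= M mn; exact: leq_ltn_trans. Qed.

(* [below N k] says that [k.+1] is a state, and conditions on the states are
   stated in this form; [u 0] is never read. *)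
Definition tsum u i : \bar R := (\sum_(i <= j <oo | in_states N j) (u j)%:E)%E.

Lemma tsum_ge0 u i : (forall j, below N j -> 0 <= u j.+1) -> (0 <= tsum u i)%E.
Proof.
move=> u0; rewrite /tsum.
by apply: nneseries_ge0 => -[|j] //= _ /u0; rewrite lee_fin.
Qed.

Lemma tsum_ext u1 u2 i :
  (forall j, (i <= j)%N -> in_states N j -> u1 j = u2 j) -> tsum u1 i = tsum u2 i.
Proof.
move=> e; rewrite /tsum; apply: congr_lim; apply/funext => n.
rewrite big_nat_cond [RHS]big_nat_cond; by apply: eq_bigr => j /andP[/andP[ij _] /e ->].
Qed.

Lemma tsum_scale u (c : R) i : (forall j, below N j -> 0 <= u j.+1) ->
  tsum (fun j => c * u j) i = (c%:E * tsum u i)%E.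
Proof. by move=> u0; rewrite /tsum -nneseriesZl// => -[|j]//= /u0; rewrite lee_fin. Qed.

Lemma le_tsum u1 u2 i : (forall j, below N j -> 0 <= u1 j.+1) ->
  (forall j, (i <= j.+1)%N -> below N j -> u1 j.+1 <= u2 j.+1) ->
  (tsum u1 i <= tsum u2 i)%E.
Proof.
(* The terms are comparable only from [i] on, so both sequences are replaced by 0 before [i]. *)
move=> u0 u12; pose cut (u : nat -> R) j := if (i <= j)%N then u j else 0.
have cutE u : tsum u i = tsum (cut u) i.
  by apply: tsum_ext => j ij _; rewrite /cut ij.
rewrite (cutE u1) (cutE u2) /tsum; apply: lee_nneseries => -[|j] //.
  by rewrite /cut => -> /u0; rewrite lee_fin.
move=> bj; rewrite /cut; case: ifP => ij; rewrite lee_fin//.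
exact: u12.
Qed.

Lemma tsum_rec u n : (forall j, below N j -> 0 <= u j.+1) -> below N n ->
  tsum u n.+1 = ((u n.+1)%:E + tsum u n.+2)%E.
Proof.
move=> u0 bn; rewrite /tsum (nneseries_split_cond n.+1 1%N); last first.
  by case=> [|j]//= /u0; rewrite lee_fin.
by rewrite addn1 big_ltn_cond// big_geq// ifT ?adde0.
Qed.

Lemma tsum_out u n : ~~ below N n -> tsum u n.+1 = 0%E.
Proof.
move=> bn; rewrite /tsum.
rewrite (_ : (fun _ => _) = cst 0%E) ?lim_cst//; apply/funext => M.
rewrite big_nat_cond big1// => -[|j] /andP[/andP[nj _]] // bj.
by move: bn; rewrite (below_le (nj : n <= j)%N bj).
Qed.

Lemma tsum_split u n : (forall j, below N j -> 0 <= u j.+1) ->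
  (forall k, (k < n)%N -> below N k) ->
  tsum u 1 = ((\sum_(k < n) u k.+1)%:E + tsum u n.+1)%E.
Proof.
move=> u0; elim: n => [|n IH] bn; first by rewrite big_ord0 add0e.
rewrite IH => [|k kn]; last exact/bn/ltnW.
by rewrite tsum_rec ?bn// big_ord_recr/= EFinD addeA.
Qed.

Lemma partial_le_tsum u n : (forall j, below N j -> 0 <= u j.+1) ->
  (forall k, (k < n)%N -> below N k) ->
  ((\sum_(k < n) u k.+1)%:E <= tsum u 1)%E.
Proof. by move=> u0 bn; rewrite (tsum_split u0 bn) leeDl// tsum_ge0. Qed.

(** Partial sums telescope to [F n] minus a later value of [F], which is nonnegative. For finite [N]
    that later index may be [N] itself, one past the last [k] with [below N k]. *)
Lemma tsum_telescope_le u (F : nat -> R) n :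
  (forall j, below N j -> 0 <= u j.+1) ->
  (forall m, (forall k, (k < m)%N -> below N k) -> 0 <= F m) ->
  (forall k, below N k -> u k.+1 <= F k - F k.+1) ->
  (forall k, (k < n)%N -> below N k) ->
  (tsum u n.+1 <= (F n)%:E)%E.
Proof.
move=> u0 F0 uF bn.
have partial d m : (forall k, (k < m)%N -> below N k) ->
    (\sum_(m.+1 <= j < m.+1 + d | in_states N j) (u j)%:E <= (F m)%:E)%E.
  elim: d m => [|d IH] m bm; first by rewrite addn0 big_geq// lee_fin F0.
  have [bbm|bbm] := boolP (below N m).
    have bm1 k : (k < m.+1)%N -> below N k by rewrite ltnS => /below_le; apply.
    rewrite big_ltn_cond; last by rewrite addnS ltnS leq_addr.
    rewrite (_ : in_states N m.+1 = true)// -addSnnS.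
    have um : ((u m.+1)%:E <= (F m - F m.+1)%:E)%E by rewrite lee_fin uF.
    by have := leeD um (IH m.+1 bm1); rewrite -EFinD subrK.
  rewrite big_nat_cond big1 ?lee_fin ?F0//.
  move=> -[|j] /andP[/andP[mj _]] // bj.
  by move: bbm; rewrite (below_le (mj : m <= j)%N bj).
rewrite /tsum; apply: lime_le.
  by apply: is_cvg_nneseries_cond => -[|j] //= _ /u0; rewrite lee_fin.
near=> M; have nM : (n.+1 <= M)%N by near: M; exact: nbhs_infty_ge.
by rewrite -(subnKC nM); exact: partial.
Unshelve. all: by end_near. Qed.

Lemma tsum_le_partial u (x : R) : (forall j, below N j -> 0 <= u j.+1) ->
  (forall n, (forall k, (k < n)%N -> below N k) -> \sum_(k < n) u k.+1 <= x) ->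
  (tsum u 1 <= x%:E)%E.
Proof.
move=> u0 ux; have := @tsum_telescope_le u (fun n => x - \sum_(k < n) u k.+1) 0.
rewrite big_ord0 subr0; apply=> // [m bm|k bk].
  by rewrite subr_ge0 ux.
by rewrite big_ord_recr/=; lra.
Qed.

End StateSeries.

(** * Picone's inequality *)

Section SummationByParts.
Context {R : realFieldType}.
Implicit Types (W q : nat -> R).
Local Open Scope ring_scope.

Lemma abel_sum W q n : q 0%N = 0 ->
  \sum_(k < n) W k * (q k.+1 - q k) =
  W n * q n + \sum_(k < n) (W k - W k.+1) * q k.+1.
Proof.
move=> q0; elim: n => [|n IH]; first by rewrite !big_ord0 q0 mulr0 addr0.
by rewrite !big_ord_recr/= IH; ring.
Qed.

(** The difference of the two sides is the square [(r x - p y)^2 / (p r)]. When [r = 0], also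
    [y = 0], and division by zero being zero leaves an equality. *)
Lemma picone (p r x y : R) : 0 < p -> 0 <= r -> (r = 0 -> y = 0) ->
  (p - r) * (x ^+ 2 / p - y ^+ 2 / r) <= (x - y) ^+ 2.
Proof.
move=> p0 r0 ry; have [r_eq0|rN0] := eqVneq r 0.
  by rewrite r_eq0 (ry r_eq0) invr0 !subr0 mulr0 subr0 mulrC divfK ?gt_eqF.
have {r0}r0 : 0 < r by rewrite lt_def rN0.
rewrite -subr_ge0 (_ : _ - _ = (r * x - p * y) ^+ 2 / (p * r)).
  by rewrite divr_ge0 ?sqr_ge0// mulr_ge0 ?ltW.
by field; rewrite rN0 gt_eqF.
Qed.

(* [W k] is the flux [c k * (h k.+1 - h k)] of the positive function [h];
   Picone's identity with [g^2 / h] and a summation by parts. *)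
Lemma picone_sum (c W h g mass : nat -> R) (lam : R) n :
  h 0%N = 0 -> g 0%N = 0 ->
  (forall k, (k < n)%N -> 0 <= c k) ->
  (forall k, (k < n)%N -> 0 < h k.+1) ->
  (forall k, (k < n)%N -> W k = c k * (h k.+1 - h k)) ->
  (forall k, (k < n)%N -> lam * (mass k.+1 * h k.+1) <= W k - W k.+1) ->
  W n * (g n ^+ 2 / h n) + lam * (\sum_(k < n) mass k.+1 * g k.+1 ^+ 2) <=
  \sum_(k < n) c k * (g k.+1 - g k) ^+ 2.
Proof.
move=> h0 g0 c0 hp Wh Wm; pose q k := g k ^+ 2 / h k.
have q0 : q 0%N = 0 by rewrite /q g0 expr0n mul0r.
apply: (@le_trans _ _ (\sum_(k < n) W k * (q k.+1 - q k))).
  rewrite abel_sum// lerD2l mulr_sumr; apply: ler_sum => k _.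
  have hk := hp k (ltn_ord k).
  have -> : lam * (mass k.+1 * g k.+1 ^+ 2) = lam * (mass k.+1 * h k.+1) * q k.+1.
    by rewrite /q; field; rewrite gt_eqF.
  by apply: ler_wpM2r; [rewrite divr_ge0 ?sqr_ge0 ?ltW|exact: Wm].
apply: ler_sum => k _; rewrite Wh// -mulrA; apply: ler_wpM2l; first exact: c0.
apply: picone; first exact: hp.
  by case: k => -[|k] /= kn; [rewrite h0|exact/ltW/hp/ltnW].
(* Among these indices [h k] vanishes only at [k = 0], where [g] vanishes as well. *)
by case: k => -[|k] /= kn // hk0; have := hp _ (ltnW kn); rewrite hk0 ltxx.
Qed.

End SummationByParts.

(** * Tails of a convergent series *)

Section Tails.
Context {R : realType} (N : option nat) (u : nat -> R).
Hypothesis u_ge0 : forall j, below N j -> (0 <= u j.+1)%R.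
Hypothesis u_fin : tsum N u 1 < +oo.
Local Open Scope ring_scope.

(** The index names an edge: [tail n] sums the states strictly above [n], as does the flux between
    [n] and [n.+1]. *)
Definition tail n : R := fine (tsum N u n.+1).

Lemma tailE n : tsum N u n.+1 = (tail n)%:E.
Proof.
rewrite fineK// ge0_fin_numE ?tsum_ge0//.
have [bn|bn] := boolP (below N n); last by rewrite tsum_out.
apply: le_lt_trans u_fin.
rewrite (@tsum_split _ N u n) => [||k kn]//; last exact: below_le (ltnW kn) bn.
rewrite leeDr// lee_fin sumr_ge0// => k _; apply: u_ge0.
exact: below_le (ltnW (ltn_ord k)) bn.
Qed.

Lemma tail_ge0 n : 0 <= tail n.
Proof. by rewrite -lee_fin -tailE tsum_ge0. Qed.

Lemma tail_rec n : below N n -> tail n = u n.+1 + tail n.+1.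
Proof. by move=> bn; apply: EFin_inj; rewrite EFinD -!tailE tsum_rec. Qed.

End Tails.

(** * The birth-death process *)

Section BirthDeath.
Context {R : realType} (N : option nat) (a b : nat -> R).
Hypothesis a_gt0 : forall i, in_states N i -> (0 < a i)%R.
Hypothesis b_gt0 : forall i, (0 < i)%N -> below N i -> (0 < b i)%R.
Hypothesis mu_fin : tsum N (mu a b) 1 < +oo.
Hypothesis N_ge1 : in_states N 1.
Hypothesis b_last : forall n, N = Some n -> b n = 0%R.
Local Open Scope ring_scope.
Implicit Types (f g v : nat -> R) (i j k m n : nat) (c lam : R).

(** The conductance of the edge from [k] to [k.+1]; edge 0 joins the Dirichlet boundary point to
    state 1. *)
Local Notation w k := (mu a b k.+1 * a k.+1).

Lemma mu1 : mu a b 1 = 1.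
Proof. by rewrite /mu !big_geq// divr1. Qed.

Lemma mu_gt0 k : below N k -> 0 < mu a b k.+1.
Proof.
move=> bk; rewrite /mu divr_gt0// big_nat_cond prodr_gt0//.
- move=> j; rewrite andbT => /andP[j0 jk]; apply: b_gt0 => //.
  exact: below_le (jk : (j <= k)%N) bk.
- move=> -[|j] //; rewrite andbT => /andP[_ jk]; apply: a_gt0.
  exact: below_le (jk : (j <= k)%N) bk.
Qed.

Lemma mu_ge0 k : below N k -> 0 <= mu a b k.+1.
Proof. by move/mu_gt0/ltW. Qed.

Lemma w_gt0 k : below N k -> 0 < w k.
Proof. by move=> bk; rewrite mulr_gt0 ?mu_gt0// a_gt0. Qed.

(** Detailed balance: the conductance can be read from either end of the edge. *)
Lemma mu_rec k : below N k.+1 -> w k.+1 = mu a b k.+1 * b k.+1.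
Proof.
move=> bk; have aN0 : a k.+2 != 0 by rewrite gt_eqF// a_gt0.
rewrite /mu big_nat_recr//= [X in _ / X * _]big_nat_recr//= invfM.
by rewrite -!mulrA mulVf// mulr1 [b _ * _]mulrC.
Qed.

Local Notation mtail := (tail N (mu a b)).

Lemma mtail_gt0 k : below N k -> 0 < mtail k.
Proof.
move=> bk; rewrite tail_rec//; last exact: mu_ge0.
by rewrite ltr_pwDl ?mu_gt0// tail_ge0//; exact: mu_ge0.
Qed.

(** * Norm and energy of stopped functions *)

Section Stopped.
Variables (m : nat) (f : nat -> R).
Hypothesis m_in : in_states N m.
Hypothesis f_stop : stopped_at N m f.

Lemma stoppedE j : (m <= j)%N -> in_states N j -> f j = f m.
Proof. by move=> mj /f_stop ->; rewrite (minn_idPr mj). Qed.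

Lemma below_lt_in k : (k < m)%N -> below N k.
Proof.
case: m m_in => // m' bm km; exact: below_le (km : (k <= m')%N) bm.
Qed.

(** Beyond the stopping point the terms are proportional to [mu]: [d] is the square of [f m] for the
    norm, 0 for the energy and [f m] for the mean. *)
Lemma tsum_stopped (u : nat -> R) (d : R) :
  (forall j, below N j -> 0 <= u j.+1) ->
  (forall j, (m < j)%N -> in_states N j -> u j = d * mu a b j) ->
  tsum N u 1 = (\sum_(k < m) u k.+1 + d * mtail m)%:E.
Proof.
move=> u0 ud; rewrite (tsum_split (n := m)) => [||k]//; last exact: below_lt_in.
rewrite (tsum_ext (u2 := fun j => d * mu a b j))//.
rewrite tsum_scale; last exact: mu_ge0.
by rewrite tailE//; exact: mu_ge0.
Qed.

Lemma mu_sq_stopped :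
  mu_sq N a b f =
  (\sum_(k < m) mu a b k.+1 * f k.+1 ^+ 2 + f m ^+ 2 * mtail m)%:E.
Proof.
apply: (@tsum_stopped (fun k => mu a b k * f k ^+ 2)) => j.
  by move=> bj; rewrite mulr_ge0 ?sqr_ge0 ?mu_ge0.
by move=> mj jN; rewrite stoppedE ?(ltnW mj)// mulrC.
Qed.

Lemma Dform_stopped :
  Dform N a b f = (\sum_(k < m) w k * (f k.+1 - ext0 f k) ^+ 2)%:E.
Proof.
rewrite -[X in X%:E]addr0 -[X in (_ + X)%:E](mul0r (mtail m)).
apply: (@tsum_stopped (fun k => mu a b k * a k * (f k - ext0 f k.-1) ^+ 2)) => j.
  by move=> bj; rewrite mulr_ge0 ?sqr_ge0// ltW// w_gt0.
case: j => // j mj jN; rewrite mul0r (stoppedE (ltnW mj) jN).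
rewrite ltnS in mj; have mN : (0 < m)%N by move: m_in => /andP[].
have -> : ext0 f j = f m.
  case: j mj jN => [|j] mj jN; first by rewrite leqn0 in mj; rewrite (eqP mj) in mN.
  by apply: stoppedE => //; exact: (below_le (leqnSn j) jN).
by rewrite subrr expr0n mulr0.
Qed.

End Stopped.

(** Both functionals are homogeneous of degree two, so [f] divided by the square root of [s] is an
    admissible test function. *)
Lemma lambda_stopped_le m f (d s : R) : in_states N m -> stopped_at N m f ->
  Dform N a b f = d%:E -> mu_sq N a b f = s%:E -> 0 < s ->
  (lambda_stopped N a b <= (d / s)%:E)%E.
Proof.
move=> mN fm Dd mus s0; set c := (Num.sqrt s)^-1.
have c2 : c ^+ 2 = s^-1 by rewrite exprVn sqr_sqrtr// ltW.
apply: ereal_inf_lbound; exists (fun i => c * f i).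
  split; last by exists m; split => // i /fm ->.
  transitivity (tsum N (fun k => c ^+ 2 * (mu a b k * f k ^+ 2)) 1).
    by apply: tsum_ext => j _ _; rewrite exprMn mulrCA.
  rewrite tsum_scale; last by move=> j bj; rewrite mulr_ge0 ?sqr_ge0 ?mu_ge0.
  rewrite c2; have -> : tsum N (fun k => mu a b k * f k ^+ 2) 1 = s%:E by [].
  by rewrite -EFinM mulVf// gt_eqF.
transitivity (tsum N (fun k => c ^+ 2 * (mu a b k * a k * (f k - ext0 f k.-1) ^+ 2)) 1).
  apply: tsum_ext => -[|[|j]] //= _ _; first by rewrite !subr0 exprMn mulrCA.
  by rewrite -mulrBr exprMn mulrCA.
rewrite tsum_scale; last first.
  by move=> j bj; rewrite mulr_ge0 ?sqr_ge0// ltW// w_gt0.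
by rewrite c2 -[tsum _ _ _]/(Dform N a b f) Dd -EFinM mulrC.
Qed.

Lemma Dform_ge0 f : (0 <= Dform N a b f)%E.
Proof. by apply: tsum_ge0 => j bj; rewrite mulr_ge0 ?sqr_ge0// ltW// w_gt0. Qed.

Lemma mu_sq_ge0 f : (0 <= mu_sq N a b f)%E.
Proof. by apply: tsum_ge0 => j bj; rewrite mulr_ge0 ?sqr_ge0// mu_ge0. Qed.

(** Substituting ratios of [g] turns the difference form into a difference of fluxes; [g 0 = 0]
    encodes the infinite [v_0]. The value [v k.+1] stays free, for the last state and the stopping
    point, and [a'] allows for the modified death rate. *)
Lemma Rop_ratio (a' g v : nat -> R) k : g 0%N = 0 -> g k.+1 != 0 ->
  ((0 < k)%N -> v k = g k.+1 / g k) ->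
  mu a b k.+1 * g k.+1 * Rop a' b v k.+1 =
  mu a b k.+1 * a' k.+1 * (g k.+1 - g k) -
  mu a b k.+1 * b k.+1 * (v k.+1 * g k.+1 - g k.+1).
Proof.
move=> g0 gN0 vk; rewrite /Rop/=.
have -> : ext0 (fun j => (v j)^-1) k = g k / g k.+1.
  by case: k vk {gN0} => [|k] /= vk; rewrite ?g0 ?mul0r// vk// invf_div.
by field.
Qed.

(** * The eigenvalue equation as a recursion *)

Section Eigenfunction.
Variable lam : R.

(** A first-order system for value and flux. The initial flux is [a 1] because [w 0 = a 1], which
    makes [eigen 1 = 1]. For finite [N] the recursion still gives a flux at index [N], where there
    is no edge. *)
Fixpoint eigen_flux n : R * R :=
  if n is k.+1 then
    let: (g, W) := eigen_flux k in
    let g' := g + W / w k in (g', W - lam * (mu a b k.+1 * g'))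
  else (0, a 1).

Definition eigen n := (eigen_flux n).1.
Definition flux n := (eigen_flux n).2.

Lemma eigenS k : eigen k.+1 = eigen k + flux k / w k.
Proof. by rewrite /eigen /flux /=; case: (eigen_flux k). Qed.

Lemma fluxS k : flux k.+1 = flux k - lam * (mu a b k.+1 * eigen k.+1).
Proof. by rewrite /eigen /flux /=; case: (eigen_flux k). Qed.

Lemma fluxE k : below N k -> flux k = w k * (eigen k.+1 - eigen k).
Proof.
by move=> bk; rewrite eigenS addrAC subrr add0r mulrC divfK// gt_eqF ?w_gt0.
Qed.

Lemma eigen_incr k : below N k -> 0 < flux k -> eigen k < eigen k.+1.
Proof. by move=> bk W0; rewrite eigenS ltrDl divr_gt0 ?w_gt0. Qed.

Lemma eigen_ge0 n : (forall k, (k < n)%N -> below N k) ->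
  (forall k, (k < n)%N -> 0 < flux k) -> 0 <= eigen n.
Proof.
elim: n => // n IH bn W0.
apply: ltW; apply: le_lt_trans (eigen_incr (bn n _) (W0 n _)) => //.
by apply: IH => k kn; [exact/bn/ltnW|exact/W0/ltnW].
Qed.

Lemma eigen_gt0 n : (forall k, (k <= n)%N -> below N k) ->
  (forall k, (k <= n)%N -> 0 < flux k) -> 0 < eigen n.+1.
Proof.
move=> bn W0; apply: le_lt_trans (eigen_incr (bn n _) (W0 n _)) => //.
by apply: eigen_ge0 => k kn; [exact/bn/ltnW|exact/W0/ltnW].
Qed.

End Eigenfunction.

(** * Positivity of the flux up to [lambda_stopped], and the difference form lower bound *)

(** For [g] stopped at [m], summation by parts gives the energy [W m * g m + lam * S]. The term
    [lam * S] cancels against the norm, and what remains is divided by [g m]. *)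
Lemma flux_ge n lam : 0 <= lam -> (lam%:E <= lambda_stopped N a b)%E ->
  below N n -> (forall k, (k <= n)%N -> 0 < flux lam k) ->
  lam * eigen lam n.+1 * mtail n.+1 <= flux lam n.+1.
Proof.
move=> lam0 lamL bn W0; set m := n.+1; set g := eigen lam; set W := flux lam.
have mN : in_states N m by [].
have blw k : (k < m)%N -> below N k by exact: below_lt_in.
have gm : 0 < g m by apply: eigen_gt0 => k kn; [exact: blw|exact: W0].
pose f i := g (minn i m).
have fm : stopped_at N m f by move=> i _; rewrite /f -minnA minnn.
have fE k : (k <= m)%N -> f k = g k by move=> /minn_idPl; rewrite /f => ->.
have eE k : (k <= m)%N -> ext0 f k = g k by case: k => //= k; exact: fE.
pose S := \sum_(k < m) mu a b k.+1 * g k.+1 ^+ 2.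
have S0 : 0 <= S.
  by apply: sumr_ge0 => k _; rewrite mulr_ge0 ?sqr_ge0 ?mu_ge0 ?blw.
have fsq : mu_sq N a b f = (S + g m ^+ 2 * mtail m)%:E.
  rewrite (mu_sq_stopped mN fm) fE//; congr (_ + _)%:E.
  by apply: eq_bigr => k _; rewrite fE.
have fD : Dform N a b f = (W m * g m + lam * S)%:E.
  rewrite (Dform_stopped mN fm); congr EFin.
  transitivity (\sum_(k < m) W k * (g k.+1 - g k)).
    apply: eq_bigr => k _; rewrite fE// eE ?(ltnW (ltn_ord k))//.
    by rewrite /W fluxE ?blw// expr2 !mulrA.
  rewrite abel_sum// mulr_sumr; congr +%R; apply: eq_bigr => k _.
  by rewrite /W fluxS -/g; ring.
have s_gt0 : 0 < S + g m ^+ 2 * mtail m.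
  rewrite /S big_ord_recr/= -addrA ltr_wpDl//.
    by apply: sumr_ge0 => k _; rewrite mulr_ge0 ?sqr_ge0 ?mu_ge0 ?blw// ltnW//= ltnS.
  apply: ltr_pwDl; first by rewrite mulr_gt0 ?exprn_gt0 ?mu_gt0.
  by rewrite mulr_ge0 ?sqr_ge0// tail_ge0//; exact: mu_ge0.
have := le_trans lamL (lambda_stopped_le mN fm fD fsq s_gt0).
rewrite lee_fin ler_pdivlMr// mulrDr [lam * S + _]addrC lerD2r => ineq.
rewrite -(ler_pM2r gm); apply: le_trans ineq.
by rewrite le_eqVlt; apply/orP; left; apply/eqP; ring.
Qed.

(** By strong induction, positive earlier fluxes feed [flux_ge], whose bound is strictly positive
    while states remain. For [lam = 0] that bound degenerates, but the flux is constant. *)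
Lemma flux_gt0 n lam : 0 <= lam -> (lam%:E <= lambda_stopped N a b)%E ->
  below N n -> 0 < flux lam n.
Proof.
move=> lam0 lamL; elim/ltn_ind: n => -[|n] IH bn.
  by rewrite /flux/= a_gt0.
have bn' : below N n by exact: below_le bn.
have W0 k : (k <= n)%N -> 0 < flux lam k.
  by move=> kn; apply: IH => //; exact: below_le kn bn'.
have [lam_eq0|lamN0] := eqVneq lam 0.
  by have := W0 n (leqnn n); rewrite fluxS lam_eq0 mul0r subr0.
have lam_gt0 : 0 < lam by rewrite lt_def lamN0.
apply: lt_le_trans (flux_ge lam0 lamL bn' W0).
rewrite !mulr_gt0 ?mtail_gt0// eigen_gt0// => k kn.
exact: below_le kn bn'.
Qed.

(** Reaches one index further than [flux_gt0]: at [n = N] the remaining mass is zero, so only a weak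
    inequality survives. *)
Lemma flux_ge0 n lam : 0 <= lam -> (lam%:E <= lambda_stopped N a b)%E ->
  (forall k, (k < n)%N -> below N k) -> 0 <= flux lam n.
Proof.
move=> lam0 lamL; case: n => [|n] bn.
  by apply/ltW/a_gt0; case: (N) N_ge1.
have pos k : (k <= n)%N -> 0 < flux lam k by move=> kn; apply: flux_gt0 => //; exact: bn.
apply: le_trans (flux_ge lam0 lamL (bn n (ltnSn n)) pos).
rewrite !mulr_ge0// ?eigen_ge0//.
by apply: tail_ge0 => //; exact: mu_ge0.
Qed.

Lemma eigen_gt0_below n lam : 0 <= lam -> (lam%:E <= lambda_stopped N a b)%E ->
  below N n -> 0 < eigen lam n.+1.
Proof.
move=> lam0 lamL bn; apply: eigen_gt0 => k kn; first exact: below_le kn bn.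
by apply: flux_gt0 => //; exact: below_le kn bn.
Qed.

Lemma b_boundary k : below N k -> ~~ below N k.+1 -> b k.+1 = 0.
Proof.
move: b_last; case: (N) => // M /(_ M erefl) bM /= kM; rewrite -leqNgt => Mk.
by have -> : k.+1 = M by apply/eqP; rewrite eqn_leq Mk kM.
Qed.

(* The birth term vanishes at [N] because [b N = 0]; there the inequality in
   [flux_ge0] replaces the recursion. *)
Lemma le_sup_V1 lam : 0 <= lam -> (lam%:E <= lambda_stopped N a b)%E ->
  (lam%:E <= ereal_sup [set infE N (fun i => (Rop a b v i)%:E) | v in @V_1 R N])%E.
Proof.
move=> lam0 lamL; set g := eigen lam.
have g0 n : below N n -> 0 < g n.+1 by exact: eigen_gt0_below.
have W0 n : below N n -> 0 < flux lam n by exact: flux_gt0.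
(* At a finite last state any value above 1 serves, since [b] vanishes there. *)
pose v i := if below N i then g i.+1 / g i else 2.
apply: le_ereal_sup_tmp; exists (infE N (fun i => (Rop a b v i)%:E)).
  exists v => // -[|i] // bi; rewrite /v; case: ifP => bi1; last by rewrite ltr1n.
  by rewrite ltr_pdivlMr ?g0// mul1r eigen_incr// W0.
apply: le_ereal_inf_tmp => _ [[|i] // bi <-]; rewrite lee_fin.
rewrite -(ler_pM2l (mulr_gt0 (mu_gt0 bi) (g0 _ bi))).
rewrite (Rop_ratio _ (g := g)) ?gt_eqF ?g0//; last first.
  by move=> _; rewrite /v ifT//; exact: bi.
rewrite -fluxE//; have [bi1|bi1] := boolP (below N i.+1).
  rewrite /v bi1 divfK ?gt_eqF ?g0// -mu_rec// -fluxE// fluxS -/g.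
  by rewrite le_eqVlt; apply/orP; left; apply/eqP; ring.
rewrite (b_boundary bi bi1) mulr0 mul0r subr0 -subr_ge0.
rewrite (_ : _ - _ = flux lam i.+1); last by rewrite fluxS -/g; ring.
by apply: flux_ge0 => // k ki; exact: below_le (ki : (k <= i)%N) bi.
Qed.

(** * Tests for extrema over the states and for [lambda_ratio] *)

Lemma le_infE (F : nat -> \bar R) (x : \bar R) :
  (x <= infE N F)%E <-> forall k, below N k -> (x <= F k.+1)%E.
Proof.
split=> [xF k bk|xF]; last by apply: le_ereal_inf_tmp => _ [[|k] // bk <-]; exact: xF.
by apply: le_trans xF _; apply: ereal_inf_lbound; exists k.+1.
Qed.

Lemma supE_le (F : nat -> \bar R) (x : \bar R) :
  (supE N F <= x)%E <-> forall k, below N k -> (F k.+1 <= x)%E.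
Proof.
split=> [xF k bk|xF]; last by apply: ge_ereal_sup => _ [[|k] // bk <-]; exact: xF.
by apply: le_trans xF; apply: ereal_sup_ubound; exists k.+1.
Qed.

Lemma mu_sq_gt0 f i : in_states N i -> f i != 0 -> (0 < mu_sq N a b f)%E.
Proof.
case: i => // i bi fi.
have u0 j : below N j -> 0 <= mu a b j.+1 * f j.+1 ^+ 2.
  by move=> bj; rewrite mulr_ge0 ?sqr_ge0 ?mu_ge0.
have bl k : (k < i.+1)%N -> below N k by move=> ki; exact: below_le (ki : (k <= i)%N) bi.
apply: lt_le_trans (partial_le_tsum (n := i.+1) u0 bl).
rewrite lte_fin big_ord_recr/= ltr_wpDl//.
  by apply: sumr_ge0 => k _; apply: u0; apply: bl; rewrite ltnW// ltnS.
by rewrite mulr_gt0 ?mu_gt0// lt_def sqrf_eq0 fi sqr_ge0.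
Qed.

(** An infinite norm would force an infinite energy, so for admissible functions the ratio is a
    genuine quotient. *)
Lemma lambda_ratio_ge c : 0 < c ->
  (forall g, (c%:E * mu_sq N a b g <= Dform N a b g)%E) ->
  (c%:E <= lambda_ratio N a b)%E.
Proof.
move=> c0 cD; apply: le_ereal_inf_tmp => _ [g [[i [iN gi]] Dg] <-].
have := cD g; have := mu_sq_gt0 iN gi; case: (mu_sq N a b g) => [s||] //.
  rewrite lte_fin => s0; rewrite inver gt_eqF//.
  by rewrite lee_pdivlMr.
by rewrite gt0_muley// leye_eq => _ /eqP Dy; rewrite Dy in Dg.
Qed.

Lemma lambda_ratio_le f i c : in_states N i -> f i != 0 ->
  (mu_sq N a b f < +oo)%E -> (Dform N a b f <= c%:E * mu_sq N a b f)%E ->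
  (lambda_ratio N a b <= c%:E)%E.
Proof.
move=> iN fi; have := mu_sq_gt0 iN fi.
case E : (mu_sq N a b f) => [s||] // s0 _ Df.
rewrite lte_fin in s0; apply: ge_ereal_inf; exists (Dform N a b f / s%:E)%E.
  exists f; last by rewrite E.
  by split; [exists i|exact: le_lt_trans Df (ltry _)].
by rewrite inver gt_eqF// lee_pdivrMr.
Qed.

(** * The potential [f II(f)] *)

Section Potential.
Variable f : nat -> R.
Hypothesis f_gt0 : positive_on N f.
Local Notation u := (fun j => mu a b j * f j).
Hypothesis f_fin : (tsum N u 1 < +oo)%E.

Lemma muf_ge0 j : below N j -> 0 <= mu a b j.+1 * f j.+1.
Proof. by move=> bj; rewrite mulr_ge0 ?mu_ge0// ltW// f_gt0. Qed.

Lemma muf_tail_ge0 k : 0 <= tail N u k.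
Proof. exact: (tail_ge0 muf_ge0 f_fin). Qed.

Lemma muf_tail_gt0 k : below N k -> 0 < tail N u k.
Proof.
move=> bk; rewrite (tail_rec muf_ge0 f_fin bk) ltr_pwDl ?muf_tail_ge0//.
by rewrite mulr_gt0 ?mu_gt0// f_gt0.
Qed.

(* [potential n] is f_n II_n(f); it is also defined, with value 0, at n = 0. *)
Definition potential n := \sum_(k < n) tail N u k / w k.

Lemma potentialS n : potential n.+1 = potential n + tail N u n / w n.
Proof. by rewrite /potential big_ord_recr. Qed.

Lemma potential0 : potential 0 = 0.
Proof. by rewrite /potential big_ord0. Qed.

Lemma le_potential m n : (m <= n)%N -> (forall k, (k < n)%N -> below N k) ->
  potential m <= potential n.
Proof.
move=> /subnKC <-; elim: (n - m)%N => [|d IH] bn; first by rewrite addn0.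
rewrite addnS potentialS; apply: le_trans (IH _) _.
  by move=> k kn; apply: bn; rewrite addnS ltnW.
by rewrite lerDl divr_ge0 ?muf_tail_ge0// ltW// w_gt0// bn// addnS.
Qed.

Lemma potential_gt0 n : below N n -> 0 < potential n.+1.
Proof.
move=> bn; rewrite potentialS ltr_wpDl ?divr_gt0 ?muf_tail_gt0 ?w_gt0//.
rewrite -potential0 le_potential// => k kn; exact: below_le (ltnW kn) bn.
Qed.

(** The tail is the flux of the potential [h]. As it drops by [mu f] at each state, [h] solves the
    Poisson equation [-Omega h = f]. *)
Lemma tail_flux k : below N k ->
  tail N u k = w k * (potential k.+1 - potential k).
Proof.
by move=> bk; rewrite potentialS addrAC subrr add0r mulrC divfK// gt_eqF ?w_gt0.
Qed.

Lemma IIopE n : below N n ->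
  IIop N a b f n.+1 = ((f n.+1)%:E^-1 * (potential n.+1)%:E)%E.
Proof.
move=> bn; rewrite /IIop; congr (_ * _)%E; rewrite big_add1 big_mkord -sumEFin.
apply: eq_bigr => k _; have bk : below N k by apply: below_le bn; rewrite -ltnS.
rewrite -[mu_tail _ _ _ _ _]/(tsum N u k.+1) (tailE muf_ge0 f_fin) inver gt_eqF ?w_gt0//.
by rewrite -EFinM mulrC.
Qed.

Lemma le_inv_IIop c n : 0 < c -> below N n ->
  (c%:E <= (IIop N a b f n.+1)^-1)%E = (c * potential n.+1 <= f n.+1).
Proof.
move=> c0 bn; rewrite IIopE// lee_inv_div ?f_gt0//.
by rewrite lee_fin ltW// potential_gt0.
Qed.

Lemma inv_IIop_le c n : 0 < c -> below N n ->
  ((IIop N a b f n.+1)^-1 <= c%:E)%E = (f n.+1 <= c * potential n.+1).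
Proof.
move=> c0 bn; rewrite IIopE// inv_div_lee ?f_gt0//.
by rewrite lee_fin ltW// potential_gt0.
Qed.

(** Dividing the single-sum bound by the conductances and adding over the edges gives the double-sum
    bound. *)
Lemma potential_le c n :
  (forall k, below N k -> c * tail N u k <= w k * (f k.+1 - ext0 f k)) ->
  (forall k, (k < n)%N -> below N k) -> c * potential n <= ext0 f n.
Proof.
move=> cf; elim: n => [|n IH] bn; first by rewrite potential0 mulr0.
rewrite potentialS mulrDr -[ext0 f n.+1](subrKC (ext0 f n)) lerD//.
  by apply: IH => k kn; exact/bn/ltnW.
by rewrite mulrA ler_pdivrMr ?w_gt0 ?bn// [leRHS]mulrC cf ?bn.
Qed.

Lemma le_potential_scale c n :
  (forall k, below N k -> w k * (f k.+1 - ext0 f k) <= c * tail N u k) ->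
  (forall k, (k < n)%N -> below N k) -> ext0 f n <= c * potential n.
Proof.
move=> cf; elim: n => [|n IH] bn; first by rewrite potential0 mulr0.
rewrite potentialS mulrDr -[ext0 f n.+1](subrKC (ext0 f n)) lerD//.
  by apply: IH => k kn; exact/bn/ltnW.
by rewrite mulrA ler_pdivlMr ?w_gt0 ?bn// [leLHS]mulrC cf ?bn.
Qed.

(** Picone's inequality with the potential as [h]: its flux drops by [mu f], which is at least
    [c mu h]. The boundary term is nonnegative and is dropped; partial sums allow an arbitrary
    [g]. *)
Lemma potential_Dform_ge c g : 0 <= c ->
  (forall n, below N n -> c * potential n.+1 <= f n.+1) ->
  (c%:E * mu_sq N a b g <= Dform N a b g)%E.
Proof.
move=> c0 cf.
have musq0 j : below N j -> 0 <= mu a b j.+1 * g j.+1 ^+ 2.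
  by move=> bj; rewrite mulr_ge0 ?sqr_ge0 ?mu_ge0.
have D0 j : below N j -> 0 <= mu a b j.+1 * a j.+1 * (g j.+1 - ext0 g j) ^+ 2.
  by move=> bj; rewrite mulr_ge0 ?sqr_ge0// ltW// w_gt0.
rewrite -[mu_sq _ _ _ _]/(tsum N (fun k => mu a b k * g k ^+ 2) 1) -tsum_scale//.
case E : (Dform N a b g) (Dform_ge0 g) => [d||] // d0; last by rewrite leey.
apply: tsum_le_partial => [j bj|n bn]; first by rewrite mulr_ge0// musq0.
rewrite -mulr_sumr -lee_fin -E.
pose uD k := mu a b k * a k * (g k - ext0 g k.-1) ^+ 2.
apply: le_trans (partial_le_tsum (u := uD) D0 bn); rewrite lee_fin.
have pic : tail N u n * (ext0 g n ^+ 2 / potential n) +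
    c * (\sum_(k < n) mu a b k.+1 * ext0 g k.+1 ^+ 2) <=
    \sum_(k < n) w k * (ext0 g k.+1 - ext0 g k) ^+ 2.
  apply: (@picone_sum _ (fun k => w k) (tail N u) potential (ext0 g)) => //.
  - exact: potential0.
  - by move=> k kn; rewrite ltW// w_gt0// bn.
  - by move=> k kn; rewrite potential_gt0// bn.
  - by move=> k kn; rewrite tail_flux// bn.
  - move=> k kn; have bk := bn _ kn.
    rewrite (tail_rec muf_ge0 f_fin bk) addrK mulrCA.
    by rewrite ler_wpM2l ?mu_ge0// cf.
apply: le_trans pic.
rewrite lerDr mulr_ge0 ?muf_tail_ge0// divr_ge0 ?sqr_ge0//.
by rewrite -potential0 le_potential.
Qed.

(** By parts, the energy up to [n] is the sum of [mu f h] up to [n] plus [potential n] times the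
    tail of [mu f]. As [h] dominates [potential n] further out, that last term is absorbed. Keeping
    [h] abstract covers the potential and its stopped version. *)
Lemma potential_energy_le (h : nat -> R) n :
  (forall k, (k < n)%N -> below N k) ->
  (forall k, (k < n)%N -> h k.+1 = potential k.+1) ->
  (forall k, (n <= k)%N -> below N k -> potential n <= h k.+1) ->
  ((\sum_(k < n) w k * (potential k.+1 - potential k) ^+ 2)%:E <=
   tsum N (fun j => mu a b j * (f j * h j))%R 1)%E.
Proof.
move=> bn hn hlarge.
have pot0 k : (k <= n)%N -> 0 <= potential k.
  move=> kn; rewrite -potential0 le_potential// => j jk.
  by apply: bn; exact: leq_trans kn.
have h0 k : below N k -> 0 <= h k.+1.
  move=> bk; have [kn|nk] := ltnP k n; first by rewrite hn// pot0.
  exact: le_trans (pot0 _ _) (hlarge _ nk bk).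
rewrite (tsum_split (n := n))//; last first.
  by move=> j bj; rewrite mulrA mulr_ge0 ?h0 ?muf_ge0.
have -> : \sum_(k < n) w k * (potential k.+1 - potential k) ^+ 2 =
    \sum_(k < n) mu a b k.+1 * (f k.+1 * h k.+1) + potential n * tail N u n.
  transitivity (\sum_(k < n) tail N u k * (potential k.+1 - potential k)).
    by apply: eq_bigr => k _; rewrite tail_flux ?bn// expr2 mulrA.
  rewrite abel_sum ?potential0// addrC [tail _ _ _ * _]mulrC; congr +%R.
  apply: eq_bigr => k _; rewrite hn//; have bk := bn _ (ltn_ord k).
  by rewrite (tail_rec muf_ge0 f_fin bk) addrK mulrA.
rewrite EFinD leeD2l// EFinM -(tailE muf_ge0 f_fin) -(tsum_scale _ _ muf_ge0).
apply: le_tsum.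
  by move=> j bj; rewrite mulr_ge0 ?muf_ge0 ?pot0.
move=> j nj bj; rewrite [leRHS]mulrA mulrC ler_wpM2l ?muf_ge0//.
exact: hlarge.
Qed.

End Potential.

(** * Lower bounds in double and single summation form *)

Lemma lambda_ratio_ge0 : (0 <= lambda_ratio N a b)%E.
Proof.
apply: le_ereal_inf_tmp => _ [f _ <-].
by rewrite mule_ge0 ?Dform_ge0// inve_ge0 mu_sq_ge0.
Qed.

Lemma mu_tail_ge0 f i : positive_on N f -> (0 <= mu_tail N a b f i)%E.
Proof. by move=> f0; apply: tsum_ge0 => j bj; exact: muf_ge0. Qed.

Lemma IIop_ge0 f k : positive_on N f -> below N k -> (0 <= IIop N a b f k.+1)%E.
Proof.
move=> f0 bk; apply: mule_ge0; first by rewrite inve_ge0 lee_fin ltW// f0.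
rewrite big_nat_cond; apply: sume_ge0 => -[|j] //; rewrite andbT => /andP[_ jk].
rewrite mule_ge0 ?mu_tail_ge0// inve_ge0 lee_fin ltW// w_gt0//.
by apply: below_le bk; rewrite -ltnS.
Qed.

Lemma IIop1_pinfty f : positive_on N f -> mu_tail N a b f 1 = +oo%E ->
  IIop N a b f 1 = +oo%E.
Proof.
move=> f0 Ty; rewrite /IIop big_nat1 Ty.
have inv_gt0 (x : R) : 0 < x -> (0 < x%:E^-1)%E.
  by move=> x0; rewrite inver gt_eqF// lte_fin invr_gt0.
by rewrite !gt0_muley// ?inv_gt0 ?f0// w_gt0.
Qed.

Lemma F_II_sup_le :
  (ereal_sup [set infE N (fun i => (IIop N a b f i)^-1) | f in @F_II R N] <=
   lambda_ratio N a b)%E.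
Proof.
apply: ge_ereal_sup => _ [f f0 <-]; apply: lee_posP => [|c c0 /le_infE cf].
  exact: lambda_ratio_ge0.
have f_fin : (tsum N (fun j => mu a b j * f j)%R 1 < +oo)%E.
  (* An infinite [mu(f)] would make the inverse of [II_1(f)] zero, contradicting the positive bound
     [c]. *)
  rewrite ltey; apply: contraPN (cf 0%N N_ge1) => /eqP /(IIop1_pinfty f0) ->.
  by rewrite invey lee_fin; apply/negP; rewrite -ltNge.
apply: lambda_ratio_ge => // g; apply: (potential_Dform_ge f0 f_fin); first exact: ltW.
by move=> n bn; rewrite -(le_inv_IIop f0 f_fin)// cf.
Qed.

Lemma F_I_incr f k : @F_I R N f -> below N k -> 0 < f k.+1 - ext0 f k.
Proof.
move=> [f0 fi] bk; rewrite subr_gt0; case: k bk => [|k] bk; first exact: f0.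
by apply: fi => //; exact: (below_le (leqnSn k) bk).
Qed.

Lemma F_I_sup_le :
  (ereal_sup [set infE N (fun i => (Iop N a b f i)^-1) | f in @F_I R N] <=
   ereal_sup [set infE N (fun i => (IIop N a b f i)^-1) | f in @F_I R N])%E.
Proof.
apply: ge_ereal_sup => _ [f fI <-]; have f0 := fI.1.
apply: le_ereal_sup_tmp; exists (infE N (fun i => (IIop N a b f i)^-1)%E).
  by exists f.
apply: lee_posP => [|c c0 /le_infE cf].
  by apply/le_infE => k bk; rewrite inve_ge0 IIop_ge0.
have cT k : below N k ->
    (c%:E * mu_tail N a b f k.+1 <= (w k * (f k.+1 - ext0 f k))%:E)%E.
  move=> bk; have := cf _ bk.
  by rewrite lee_inv_div ?mu_tail_ge0// mulr_gt0 ?w_gt0// F_I_incr.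
have f_fin : (tsum N (fun j => mu a b j * f j)%R 1 < +oo)%E.
  rewrite ltey; apply: contraPN (cT 0%N N_ge1) => /eqP Ty.
  by rewrite /mu_tail [X in (_ * X)%E]Ty gt0_muley.
apply/le_infE => n bn; rewrite (le_inv_IIop f0 f_fin)//.
apply: (potential_le (f := f) (n := n.+1)) => [k bk|k kn].
  rewrite -lee_fin EFinM -tailE//; first exact: cT.
  by move=> j; exact: muf_ge0.
exact: below_le (kn : (k <= n)%N) bn.
Qed.

(** * From ratios back to functions *)

(** The product of [v 1] to [v n.-1], which inverts the passage to ratios; the value 0 at 0 builds
    in the boundary condition. *)
Fixpoint vprod v n : R :=
  if n is k.+1 then (if k is 0 then 1 else vprod v k * v k) else 0.

Lemma vprodSS v k : vprod v k.+2 = vprod v k.+1 * v k.+1.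
Proof. by []. Qed.

Lemma vprod_gt0 v n : (forall k, (0 < k)%N -> (k <= n)%N -> 0 < v k) ->
  0 < vprod v n.+1.
Proof.
elim: n => [|n IH] v0; first exact: ltr01.
rewrite vprodSS mulr_gt0 ?v0//.
by apply: IH => k k0 kn; apply: v0 => //; exact: leqW.
Qed.

Lemma vprod_ratio v k : vprod v k != 0 -> (0 < k)%N -> v k = vprod v k.+1 / vprod v k.
Proof. by case: k => // k vN0 _; rewrite vprodSS mulrC mulKf. Qed.

Lemma lt_of_steps (f : nat -> R) m :
  (forall k, (0 < k)%N -> (k < m)%N -> f k < f k.+1) ->
  forall i j, (0 < i)%N -> (i < j)%N -> (j <= m)%N -> f i < f j.
Proof.
move=> fS i j i0; elim: j => // j IH; rewrite ltnS leq_eqVlt => /predU1P[<-|ij] jm.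
  exact: fS.
by apply: lt_trans (IH ij (ltnW jm)) (fS _ _ jm); exact: leq_trans ij.
Qed.

(** For [f = vprod v], the bound [c <= R_i(v)] says that the flux of [f] drops by at least
    [c mu_i f_i] at [i]; summing over the states from [i] on gives the single summation bound. *)
Lemma V_1_sup_le :
  (ereal_sup [set infE N (fun i => (Rop a b v i)%:E) | v in @V_1 R N] <=
   ereal_sup [set infE N (fun i => (Iop N a b f i)^-1) | f in @F_I R N])%E.
Proof.
apply: ge_ereal_sup => _ [v v1 <-]; pose f := vprod v.
have v_gt0 k : below N k -> 0 < v k.+1 by move=> bk; exact: lt_trans (v1 k.+1 bk).
have f_gt0 k : below N k -> 0 < f k.+1.
  move=> bk; apply: vprod_gt0 => -[|j] // _ jk; apply: v_gt0.
  exact: below_le (ltnW jk) bk.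
have f_incr k : below N k -> 0 < f k.+1 - f k.
  rewrite subr_gt0; case: k => [|k] bk; first exact: f_gt0.
  have bk' : below N k by exact: below_le bk.
  by rewrite [f k.+2]vprodSS ltr_pMr ?f_gt0//; exact: v1.
have fF : @F_I R N f.
  split=> [[|k] // bk|i j iN jN ij]; first exact: f_gt0.
  apply: (lt_of_steps (m := j)) => // [k k0 kj|]; last by case/andP: iN.
  rewrite -subr_gt0 f_incr//; case: j jN kj {ij} => // j bj kj.
  exact: below_le (kj : (k <= j)%N) bj.
apply: le_ereal_sup_tmp; exists (infE N (fun i => (Iop N a b f i)^-1)%E).
  by exists f.
apply: lee_posP => [|c c0 /le_infE cv]; apply/le_infE => n bn.
  rewrite inve_ge0 mule_ge0 ?mu_tail_ge0//; last exact: fF.1.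
  by rewrite inve_ge0 lee_fin mulr_ge0 ?ltW ?w_gt0// F_I_incr.
rewrite lee_inv_div ?mu_tail_ge0//; [|by rewrite mulr_gt0 ?w_gt0// F_I_incr|exact: fF.1].
rewrite /mu_tail -[X in (_ * X)%E]/(tsum N (fun j => mu a b j * f j)%R n.+1).
have u0 j : below N j -> 0 <= mu a b j.+1 * f j.+1.
  by move=> bj; rewrite mulr_ge0 ?mu_ge0// ltW// f_gt0.
(* The flux is cut to zero beyond a finite last state, in agreement with the vanishing birth term
   there. *)
rewrite -tsum_scale//; pose W k := if below N k then w k * (f k.+1 - f k) else 0.
have -> : (w n * (f n.+1 - ext0 f n)) = W n by rewrite /W bn; case: (n).
apply: tsum_telescope_le => [j bj|m _|k bk|k kn].
- by rewrite mulr_ge0 ?u0// ltW.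
- by rewrite /W; case: ifP => // bm; rewrite ltW// mulr_gt0 ?w_gt0// f_incr.
- have := cv _ bk; rewrite lee_fin -(ler_pM2l (mulr_gt0 (mu_gt0 bk) (f_gt0 _ bk))).
  rewrite (Rop_ratio _ (g := f)) ?gt_eqF ?f_gt0//; last first.
    move=> k0; apply: vprod_ratio => //; case: k k0 bk => // k _ bk.
    by rewrite gt_eqF// f_gt0//; exact: below_le bk.
  rewrite mulrC => /le_trans; apply; rewrite /W bk lerD2l lerN2.
  case: ifPn => bk1; last by rewrite b_boundary// mulr0 mul0r.
  by rewrite mu_rec// [f k.+2]vprodSS [v _ * _]mulrC.
- exact: below_le (ltnW kn) bn.
Qed.

(** * Comparison of the three infima *)

Lemma lambda_ratio_le_norm : (lambda_ratio N a b <= lambda_norm N a b)%E.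
Proof.
apply: le_ereal_inf_tmp => _ [f f1 <-].
have [->|Dy] := eqVneq (Dform N a b f) +oo%E; first exact: leey.
apply: ereal_inf_lbound; exists f; last by rewrite f1 inve1 mule1.
split; last by rewrite ltey.
apply: contrapT => fz; suff : (mu_sq N a b f <= 0)%E by rewrite f1 leNgt lte01.
have f_eq0 j : below N j -> f j.+1 = 0.
  by move=> bj; apply/eqP/negPn/negP => fj; apply: fz; exists j.+1.
apply: tsum_le_partial => [j bj|n bn]; first by rewrite f_eq0// expr0n mulr0.
by rewrite big1// => k _; rewrite f_eq0 ?bn// expr0n mulr0.
Qed.

Lemma lambda_norm_le_stopped : (lambda_norm N a b <= lambda_stopped N a b)%E.
Proof. by apply: ereal_inf_le_tmp => _ [f [f1 _] <-]; exists f. Qed.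

(** * Upper bounds in double summation form *)

Lemma supE_ge0 (F : nat -> \bar R) :
  (forall k, below N k -> (0 <= F k.+1)%E) -> (0 <= supE N F)%E.
Proof.
move=> F0; apply: le_trans (F0 0%N N_ge1) _.
by apply: ereal_sup_ubound; exists 1%N.
Qed.

Lemma stopped_fin m f : in_states N m -> stopped_at N m f -> positive_on N f ->
  (tsum N (fun j => mu a b j * f j)%R 1 < +oo)%E.
Proof.
move=> mN fm f0; rewrite (tsum_stopped mN (d := f m)) ?ltry// => j.
  by move=> bj; exact: muf_ge0.
by move=> mj jN; rewrite (stoppedE fm (ltnW mj) jN) mulrC.
Qed.

(** The test function [h] is the potential stopped where [f] is. Then [f <= c h] on all states, so
    the energy of [h] is at most [mu(f h)], hence at most [c mu(h^2)]. *)
Lemma lambda_ratio_le_tF_II f : @tF_II R N f ->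
  (lambda_ratio N a b <= supE N (fun i => (IIop N a b f i)^-1))%E.
Proof.
move=> [m [mN fm f0]]; have f_fin := stopped_fin mN fm f0.
apply: gee_posP => [|c c0 /supE_le cf].
  by apply: supE_ge0 => k bk; rewrite inve_ge0 IIop_ge0.
have {}cf n : below N n -> f n.+1 <= c * potential f n.+1.
  by move=> bn; rewrite -(inv_IIop_le f0 f_fin)// cf.
have m0 : (0 < m)%N by case/andP: mN.
have blw := below_lt_in mN.
pose h i := potential f (minn i m).
have hm : stopped_at N m h by move=> i _; rewrite /h -minnA minnn.
have hE k : (k <= m)%N -> h k = potential f k by move=> /minn_idPl; rewrite /h => ->.
have hL k : (m <= k)%N -> h k = potential f m by move=> /minn_idPr; rewrite /h => ->.
have pot_ge0 k : (k <= m)%N -> 0 <= potential f k.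
  move=> km; rewrite -(potential0 f) (le_potential f0 f_fin)// => j jk.
  by apply: blw; exact: leq_trans km.
have h_ge0 k : 0 <= h k by exact/pot_ge0/geq_minr.
have fh j : below N j -> f j.+1 <= c * h j.+1.
  move=> bj; have [jm|mj] := ltnP j m; first by rewrite hE// cf.
  rewrite (stoppedE fm (leqW mj) bj) (hL _ (leqW mj)).
  by case: (m) mN => // m'; exact: cf.
apply: (@lambda_ratio_le h 1) => //.
- by rewrite hE// gt_eqF// (potential_gt0 f0 f_fin).
- by rewrite (mu_sq_stopped mN hm) ltry.
rewrite (Dform_stopped mN hm).
have -> : \sum_(k < m) w k * (h k.+1 - ext0 h k) ^+ 2 =
    \sum_(k < m) w k * (potential f k.+1 - potential f k) ^+ 2.
  apply: eq_bigr => -[k km] _ /=; rewrite hE//.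
  have -> : ext0 h k = potential f k; last by [].
  by case: k km => [|k] km /=; rewrite ?potential0// hE// ltnW.
apply: le_trans (potential_energy_le f0 f_fin (h := h) blw _ _) _.
- by move=> k km; rewrite hE.
- by move=> k mk bk; rewrite hL// leqW.
rewrite -[mu_sq _ _ _ _]/(tsum N (fun k => mu a b k * h k ^+ 2)%R 1) -tsum_scale.
  apply: le_tsum => [j bj|j _ bj].
    by rewrite mulr_ge0 ?mu_ge0// mulr_ge0// ltW// f0.
  by rewrite [leRHS]mulrCA ler_wpM2l ?mu_ge0// expr2 mulrA ler_wpM2r// fh.
by move=> j bj; rewrite mulr_ge0 ?sqr_ge0 ?mu_ge0.
Qed.

(** An infinite [mu(f)] would already make the term at state 1 of the square norm infinite. *)
Lemma tF_II'_fin f : tF_II' N a b f ->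
  (tsum N (fun j => mu a b j * f j)%R 1 < +oo)%E.
Proof.
move=> [f0 L2]; rewrite ltey; apply: contraTN L2 => /eqP /(IIop1_pinfty f0) IIy.
rewrite -leNgt /mu_sum (nneseries_split_cond 1%N 1%N); last first.
  by move=> [|k] //= bk; rewrite mule_ge0 ?lee_fin ?mu_ge0// sqre_ge0.
rewrite addn1 big_nat_cond big_mkcond/= big_ltn// big_geq// N_ge1 mu1 mul1e adde0 IIy.
rewrite gt0_muley ?lte_fin ?f0// mulyy leeDl//; apply: nneseries_ge0 => -[|k] //= _ bk.
by apply: mule_ge0; [rewrite lee_fin mu_ge0|exact: sqre_ge0].
Qed.

(** Square integrability lets the unstopped potential be the test function; its energy is bounded
    through partial sums. *)
Lemma lambda_ratio_le_tF_II' f : tF_II' N a b f ->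
  (lambda_ratio N a b <= supE N (fun i => (IIop N a b f i)^-1))%E.
Proof.
move=> fF; have f_fin := tF_II'_fin fF; have [f0 L2] := fF.
apply: gee_posP => [|c c0 /supE_le cf].
  by apply: supE_ge0 => k bk; rewrite inve_ge0 IIop_ge0.
have {}cf n : below N n -> f n.+1 <= c * potential f n.+1.
  by move=> bn; rewrite -(inv_IIop_le f0 f_fin)// cf.
have pot_ge0 k : below N k -> 0 <= potential f k.+1.
  by move=> bk; rewrite ltW// (potential_gt0 f0 f_fin).
have musq0 j : below N j -> 0 <= mu a b j.+1 * potential f j.+1 ^+ 2.
  by move=> bj; rewrite mulr_ge0 ?sqr_ge0 ?mu_ge0.
have sq_fin : (mu_sq N a b (potential f) < +oo)%E.
  apply: le_lt_trans L2; rewrite /mu_sq /mu_sum; apply: lee_nneseries.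
    by move=> [|k] //= _ bk; rewrite lee_fin musq0.
  move=> [|k] // bk; rewrite (IIopE f0 f_fin)// inver gt_eqF ?f0//.
  by rewrite -EFinM -EFinM mulVKf ?gt_eqF ?f0// -EFin_expe -EFinM.
apply: (@lambda_ratio_le (potential f) 1) => //.
  by rewrite gt_eqF// (potential_gt0 f0 f_fin).
have sqE : mu_sq N a b (potential f) = (fine (mu_sq N a b (potential f)))%:E.
  by rewrite fineK// ge0_fin_numE ?mu_sq_ge0.
rewrite sqE -EFinM; apply: tsum_le_partial => [j bj|n bn].
  by rewrite mulr_ge0 ?sqr_ge0// ltW// w_gt0.
rewrite -lee_fin EFinM -sqE.
have -> : \sum_(k < n) mu a b k.+1 * a k.+1 *
      (potential f k.+1 - ext0 (potential f) k.+1.-1) ^+ 2 =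
    \sum_(k < n) w k * (potential f k.+1 - potential f k) ^+ 2.
  by apply: eq_bigr => -[[|k] km] _ //=; rewrite potential0.
apply: le_trans (potential_energy_le f0 f_fin (h := potential f) bn _ _) _.
- by [].
- move=> k nk bk; apply: (le_potential f0 f_fin); first exact: leqW.
  by move=> j jk; exact: below_le (jk : (j <= k)%N) bk.
rewrite -[mu_sq _ _ _ _]/(tsum N (fun k => mu a b k * potential f k ^+ 2)%R 1).
rewrite -tsum_scale//; apply: le_tsum => [j bj|j _ bj].
  by rewrite mulr_ge0 ?mu_ge0// mulr_ge0 ?pot_ge0// ltW// f0.
by rewrite [leRHS]mulrCA ler_wpM2l ?mu_ge0// expr2 mulrA ler_wpM2r ?pot_ge0// cf.
Qed.

(** * Upper bounds in single summation and difference form *)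

Lemma Iop_ge0 f k : positive_on N f -> below N k -> 0 <= f k.+1 - ext0 f k ->
  (0 <= Iop N a b f k.+1)%E.
Proof.
move=> f0 bk fk; rewrite mule_ge0 ?mu_tail_ge0// inve_ge0 lee_fin mulr_ge0//.
by rewrite ltW// w_gt0.
Qed.

(** Extends [inv_div_lee] to a zero increment, as occurs past the stopping point: there [I] is [+oo]
    because the tail is positive, and both sides hold. *)
Lemma inv_Iop_le f k c : positive_on N f -> 0 < c -> below N k ->
  0 <= f k.+1 - ext0 f k ->
  ((Iop N a b f k.+1)^-1 <= c%:E)%E =
  ((w k * (f k.+1 - ext0 f k))%:E <= c%:E * mu_tail N a b f k.+1)%E.
Proof.
move=> f0 c0 bk; rewrite le_eqVlt => /predU1P[fk|fk]; last first.
  by rewrite inv_div_lee ?mu_tail_ge0// mulr_gt0// w_gt0.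
rewrite /Iop/= -fk mulr0 inve0 gt0_mulye.
  by rewrite invey lee_fin ltW// mule_ge0 ?mu_tail_ge0// lee_fin ltW.
apply: (@lt_le_trans _ _ (mu a b k.+1 * f k.+1)%:E).
  by rewrite lte_fin mulr_gt0 ?mu_gt0// f0.
rewrite /mu_tail -[leRHS]/(tsum N (fun j => mu a b j * f j)%R k.+1) tsum_rec//.
  by rewrite leeDl// tsum_ge0// => j bj; exact: muf_ge0.
by move=> j bj; exact: muf_ge0.
Qed.

Lemma tF_I_tF_II : @tF_I R N `<=` @tF_II R N.
Proof. by move=> f [m [? ? ? _]]; exists m. Qed.

Lemma tF_I_step f k : @tF_I R N f -> below N k -> 0 <= f k.+1 - ext0 f k.
Proof.
move=> [m [mN fm f0 fi]] bk; rewrite subr_ge0; case: k bk => [|k] bk.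
  by rewrite ltW// f0.
have bk' : below N k by exact: below_le bk.
have [km|mk] := ltnP k.+1 m; first by rewrite ltW// fi.
by rewrite /= (stoppedE fm (leqW mk) bk) (stoppedE fm mk bk').
Qed.

Lemma tF_I_II_le_I :
  (ereal_inf [set supE N (fun i => (IIop N a b f i)^-1) | f in @tF_I R N] <=
   ereal_inf [set supE N (fun i => (Iop N a b f i)^-1) | f in @tF_I R N])%E.
Proof.
apply: le_ereal_inf_tmp => _ [f fI <-].
have [m [mN fm f0 _]] := fI; have f_fin := stopped_fin mN fm f0.
apply: ge_ereal_inf; exists (supE N (fun i => (IIop N a b f i)^-1)%E).
  by exists f.
apply: gee_posP => [|c c0 /supE_le cf].
  by apply: supE_ge0 => k bk; rewrite inve_ge0 Iop_ge0// tF_I_step.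
apply/supE_le => n bn; rewrite (inv_IIop_le f0 f_fin)//.
apply: (le_potential_scale (f := f) (n := n.+1)) => [k bk|k kn].
  rewrite -lee_fin (EFinM c) -tailE//.
    by have := cf _ bk; rewrite inv_Iop_le// tF_I_step.
  by move=> j; exact: muf_ge0.
exact: below_le (kn : (k <= n)%N) bn.
Qed.

Lemma tail_stopped m f k : in_states N m -> stopped_at N m f -> positive_on N f ->
  (m <= k.+1)%N -> tail N (fun j => mu a b j * f j) k = f m * mtail k.
Proof.
move=> mN fm f0 mk; apply: EFin_inj; rewrite EFinM -(tailE mu_ge0 mu_fin).
rewrite -(tsum_scale _ _ mu_ge0) -(tailE (muf_ge0 f0) (stopped_fin mN fm f0)).
by apply: tsum_ext => j kj jN; rewrite (stoppedE fm (leq_trans mk kj) jN) mulrC.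
Qed.

Lemma tilde_aE m : tilde_a N a b m.+1 m.+1 = w m / mtail m.
Proof.
rewrite /tilde_a eqxx /tail; congr (_ / fine _).
by apply: tsum_ext => j _ _; rewrite mulr1.
Qed.

(** Here [f = vprod v] increases up to the stopping point and is constant after it. The modified
    death rate turns the bound there into the single-sum bound, which then propagates downwards. *)
Lemma tV_1_inf_ge :
  (ereal_inf [set supE N (fun i => (Iop N a b f i)^-1) | f in @tF_I R N] <=
   ereal_inf [set supE N (fun i => (tildeRop N a b p.1 p.2 i)%:E)
             | p in tV_1 N a b])%E.
Proof.
apply: le_ereal_inf_tmp => _ [[m v] /= [mN v1 ve] <-]; pose f := vprod v.
case: m mN v1 ve => // m bm v1 ve.
have v_ge1 k : below N k -> 1 <= v k.+1.
  move=> bk; have [km|mk] := ltnP k m; first by have /andP[/ltW] := v1 k.+1 isT km.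
  by rewrite ve.
have v_gt0 k : below N k -> 0 < v k.+1 by move=> bk; exact: lt_le_trans (v_ge1 k bk).
have f_gt0 k : below N k -> 0 < f k.+1.
  move=> bk; apply: vprod_gt0 => -[|j] // _ jk; apply: v_gt0.
  exact: below_le (ltnW jk) bk.
have f_pos : positive_on N f by move=> [|k] //; exact: f_gt0.
have bl k : (k <= m)%N -> below N k by move=> km; exact: below_le km bm.
have f_incr k : (k <= m)%N -> f k < f k.+1.
  case: k => [|k] km; first exact: f_gt0.
  rewrite [f k.+2]vprodSS ltr_pMr; first by have /andP[] := v1 k.+1 isT km.
  by apply: f_gt0; apply: bl; exact: ltnW.
have f_stop : stopped_at N m.+1 f.
  move=> i; have [im|mi] := leqP i m.+1; first by [].
  rewrite -(subnKC (ltnW mi)).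
  elim: (i - m.+1)%N => [|d IH]; first by rewrite addn0.
  rewrite addnS => iN.
  have iN' : in_states N (m.+1 + d) by exact: (below_le (leqnSn _) iN).
  have vd : v (m.+1 + d)%N = 1 by apply: ve => //; rewrite addSn ltnS leq_addr.
  rewrite -(IH iN') addSn; rewrite addSn in vd.
  by rewrite /f vprodSS vd mulr1.
have fF : @tF_I R N f.
  exists m.+1; split => // i j i0 ij jm.
  by apply: (lt_of_steps (m := m.+1)) => // k _ km; exact: f_incr.
have ext0f k : ext0 f k = f k by case: k.
apply: ge_ereal_inf; exists (supE N (fun i => (Iop N a b f i)^-1)%E); first by exists f.
have Rm (a' : nat -> R) k : below N k ->
    mu a b k.+1 * f k.+1 * Rop a' b v k.+1 =
    mu a b k.+1 * a' k.+1 * (f k.+1 - f k) -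
    mu a b k.+1 * b k.+1 * (v k.+1 * f k.+1 - f k.+1).
  move=> bk; apply: Rop_ratio => //; first by rewrite gt_eqF// f_gt0.
  move=> k0; apply: vprod_ratio => //; case: k k0 bk => // k _ bk.
  by rewrite gt_eqF// f_gt0//; exact: below_le bk.
apply: gee_posP => [|c c0 /supE_le cR].
  (* At the stopping index the birth term vanishes, so the value there is nonnegative and so is the
     supremum. *)
  apply: (@le_trans _ _ (tildeRop N a b m.+1 v m.+1)%:E); last first.
    by apply: ereal_sup_ubound; exists m.+1.
  rewrite lee_fin -(pmulr_rge0 _ (mulr_gt0 (mu_gt0 bm) (f_gt0 _ bm))) Rm// ve//.
  rewrite mul1r subrr mulr0 subr0 tilde_aE; apply: mulr_ge0.
    rewrite mulr_ge0 ?mu_ge0// divr_ge0 ?(ltW (w_gt0 bm))//.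
    exact/ltW/mtail_gt0.
  by rewrite subr_ge0 ltW// f_incr.
pose T := tail N (fun j => mu a b j * f j).
have u0 j : below N j -> 0 <= mu a b j.+1 * f j.+1 by move=> bj; exact: muf_ge0.
have f_fin := stopped_fin (bm : in_states N m.+1) f_stop f_pos.
have {}cR k : below N k -> mu a b k.+1 * f k.+1 * tildeRop N a b m.+1 v k.+1 <=
    mu a b k.+1 * f k.+1 * c.
  move=> bk; have := cR _ bk; rewrite lee_fin => cRk.
  by rewrite ler_pM2l// mulr_gt0 ?mu_gt0 ?f_gt0.
(* Induction on the distance [d] to the stopping point: each state adds [c mu f] to the bound. *)
have flux_le d k : (k + d = m)%N -> w k * (f k.+1 - f k) <= c * T k.
  elim: d k => [|d IH] k kd.
    have {kd}-> : k = m by rewrite -kd addn0.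
    rewrite /T (tail_stopped bm f_stop)//.
    have := cR _ bm; rewrite Rm// ve// mul1r subrr mulr0 subr0 tilde_aE.
    rewrite (_ : _ * (f m.+1 - f m) =
      mu a b m.+1 * ((w m * (f m.+1 - f m)) / mtail m)); last by ring.
    rewrite -[leRHS]mulrA ler_pM2l ?mu_gt0// ler_pdivrMr ?mtail_gt0//.
    by move/le_trans; apply; rewrite mulrAC mulrC.
  have km : (k < m)%N by rewrite -kd addnS ltnS leq_addr.
  have bk1 : below N k.+1 by exact: bl.
  have bk : below N k by exact: below_le bk1.
  have := cR _ bk; rewrite Rm// /tilde_a ltn_eqF ?ltnS// -mu_rec// => cRk.
  have := IH k.+1; rewrite addSnnS => /(_ kd) IHk.
  rewrite /T (tail_rec u0 f_fin bk) mulrDr -/T.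
  move: cRk IHk; rewrite [f k.+2]vprodSS -/f [v _ * _]mulrC.
  by rewrite [_ * c]mulrC; lra.
apply/supE_le => k bk; rewrite inv_Iop_le ?tF_I_step// ext0f.
have [km|mk] := leqP k m.
  have := @flux_le (m - k)%N k; rewrite subnKC// => /(_ erefl).
  by rewrite -lee_fin (EFinM c) /T -tailE.
have -> : f k.+1 = f k.
  case: k bk mk => // k bk mk; have bk' : below N k by exact: below_le bk.
  by rewrite (stoppedE f_stop (leqW mk) bk) (stoppedE f_stop mk bk').
by rewrite subrr mulr0 mule_ge0 ?mu_tail_ge0// lee_fin ltW.
Qed.

(** * The flux above [lambda_stopped], and the difference form upper bound *)

(** If no state were bad, all fluxes would be positive and Picone's inequality with [g] would bound
    the energy of every normalised stopped function below by [lam]. Taking the least bad index keeps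
    the earlier fluxes positive. *)
Lemma exists_flux_le lam : 0 < lam -> (lambda_stopped N a b < lam%:E)%E ->
  exists m, [/\ below N m, forall k, (k <= m)%N -> 0 < flux lam k &
    flux lam m.+1 <= lam * (eigen lam m.+1 * mtail m.+1)].
Proof.
move=> lam0 lamL; set g := eigen lam; set W := flux lam.
pose bad m := below N m && (W m.+1 <= lam * (g m.+1 * mtail m.+1)).
have W_gt0 n : below N n -> (forall k, (k < n)%N -> ~~ bad k) ->
    forall k, (k <= n)%N -> 0 < W k.
  move=> bn nbad; elim/ltn_ind => -[|k] IH kn.
    by rewrite /W /flux/= a_gt0.
  have bk : below N k by exact: below_le (ltnW kn) bn.
  have := nbad _ kn; rewrite /bad bk/= -ltNge; apply: le_lt_trans.
  rewrite mulr_ge0 ?(ltW lam0)// mulr_ge0//; last by apply: tail_ge0 => //; exact: mu_ge0.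
  rewrite ltW// eigen_gt0// => j jk; first exact: below_le jk bk.
  by apply: IH => //; exact: leq_trans jk (ltnW kn).
have [m0 bad0] : exists m, bad m.
  have [_ [f [f1 [m [mN fm]]] <-]] := ereal_inf_lt lamL.
  apply: contraPP => nbad; apply/negP; rewrite -leNgt.
  have {}nbad k : ~~ bad k by apply/negP => bk; apply: nbad; exists k.
  rewrite -[leLHS]mule1 -f1 (mu_sq_stopped mN fm) (Dform_stopped mN fm) lee_fin.
  have blw := below_lt_in mN.
  have g_gt0 k : (k < m)%N -> 0 < g k.+1.
    move=> km; apply: eigen_gt0 => j jk; first exact: below_le jk (blw _ km).
    by apply: (W_gt0 k) => //; exact: blw.
  have pic : W m * (ext0 f m ^+ 2 / g m) +
      lam * (\sum_(k < m) mu a b k.+1 * ext0 f k.+1 ^+ 2) <=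
      \sum_(k < m) w k * (ext0 f k.+1 - ext0 f k) ^+ 2.
    apply: (@picone_sum _ (fun k => w k) W g (ext0 f)) => // k km.
    - by rewrite ltW// w_gt0// blw.
    - by rewrite /W fluxE// blw.
    - by rewrite /W fluxS -/g; lra.
  (* The Picone boundary term must outweigh the mass of [f] past [m]; this is the failure of [bad]
     at [m.-1]. *)
  apply: le_trans pic; rewrite mulrDr addrC lerD2r.
  case: m mN fm blw g_gt0 => // m bm fm blw g_gt0 /=.
  have := nbad m; rewrite /bad (bm : below N m)/= -ltNge => /ltW Wm.
  have gm := g_gt0 m (leqnn _).
  rewrite [leRHS]mulrA ler_pdivlMr// [leRHS]mulrC.
  rewrite (_ : _ * g m.+1 = f m.+1 ^+ 2 * (lam * (g m.+1 * mtail m.+1))); last by ring.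
  by apply: ler_wpM2l => //; exact: sqr_ge0.
have /ex_minnP [m /andP[bm Wm] mmin] : exists m, bad m by exists m0.
exists m; split => // k km; apply: (W_gt0 m) => // j jm.
by apply/negP => /mmin; rewrite leqNgt jm.
Qed.

(** Up to [m] the ratios of [g] give exactly [lam]; at [m.+1] the flux inequality gives at most
    [lam]; beyond, both terms vanish. *)
Lemma tV_1_inf_le lam : 0 < lam -> (lambda_stopped N a b < lam%:E)%E ->
  (ereal_inf [set supE N (fun i => (tildeRop N a b p.1 p.2 i)%:E)
             | p in tV_1 N a b] <= lam%:E)%E.
Proof.
move=> lam0 /(exists_flux_le lam0)[m [bm W0 Wm]]; set g := eigen lam.
have bl k : (k <= m)%N -> below N k by move=> km; exact: below_le km bm.
have g_gt0 k : (k <= m)%N -> 0 < g k.+1.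
  move=> km; apply: eigen_gt0 => j jk; first exact: bl (leq_trans jk km).
  exact: W0 (leq_trans jk km).
have g_neq0 k : (k <= m)%N -> g k.+1 != 0 by move=> km; rewrite gt_eqF// g_gt0.
pose v i := if (i <= m)%N then g i.+1 / g i else 1.
have Rv (a' : nat -> R) k : (k <= m)%N ->
    mu a b k.+1 * g k.+1 * Rop a' b v k.+1 =
    mu a b k.+1 * a' k.+1 * (g k.+1 - g k) -
    mu a b k.+1 * b k.+1 * (v k.+1 * g k.+1 - g k.+1).
  move=> km; apply: Rop_ratio => //; first exact: g_neq0.
  by move=> _; rewrite /v km.
have Rlt k : (k < m)%N -> Rop a b v k.+1 = lam.
  move=> km; have km' := ltnW km; have bk := bl _ km'.
  apply: (mulfI (mulf_neq0 (lt0r_neq0 (mu_gt0 bk)) (g_neq0 _ km'))).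
  rewrite Rv// /v km divfK ?g_neq0// -mu_rec ?bl// -!fluxE ?bl// fluxS -/g.
  by ring.
apply: ge_ereal_inf; exists (supE N (fun i => (tildeRop N a b m.+1 v i)%:E)).
  exists (m.+1, v) => //; split => // [[|k] // _ km|i _ mi]; last first.
    by rewrite /v leqNgt mi.
  have km' : (k < m)%N by [].
  have bk1 := bl _ km'; have b0 : 0 < b k.+1 by exact: b_gt0.
  apply/andP; split.
    rewrite /v km' (ltr_pdivlMr _ _ (g_gt0 k (ltnW km'))) mul1r.
    by apply: eigen_incr => //; exact: W0.
  (* The upper constraint on [v] in [tV_1] says that [R] is positive, which holds as it equals
     [lam]. *)
  have := Rlt _ km'; rewrite /Rop/= => RE.
  rewrite -ltrBlDl ltr_pdivlMr// mulrC -subr_gt0.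
  by rewrite (_ : _ - _ = lam)// -RE; ring.
apply/supE_le => k bk; rewrite lee_fin /tildeRop.
have [km|mk|->] := ltngtP k m.
- by rewrite -(Rlt _ km) /Rop/= /tilde_a ltn_eqF// ltnS.
- rewrite /Rop /v leqNgt (leqW mk)/= subrr mulr0 addr0.
  by case: k mk {bk} => // k mk /=; rewrite leqNgt mk invr1 subrr mulr0 ltW.
rewrite -(ler_pM2l (mulr_gt0 (mu_gt0 bm) (g_gt0 _ (leqnn m)))) Rv//.
rewrite {1}/v ltnn mul1r subrr mulr0 subr0 tilde_aE.
rewrite (_ : _ * (g m.+1 - g m) =
  mu a b m.+1 * ((w m * (g m.+1 - g m)) / mtail m)); last by ring.
rewrite -[leRHS]mulrA ler_pM2l ?mu_gt0// ler_pdivrMr ?mtail_gt0// -fluxE//.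
(* Restoring the mass of state [m.+1] to the tail moves the inequality from the flux at [m.+1] to
   the flux at [m]. *)
rewrite (tail_rec mu_ge0 mu_fin bm); move: Wm; rewrite fluxS -/g; lra.
Qed.

(** Finiteness comes from the constant function 1, which is stopped at 1 and has finite energy. *)
Lemma lambda_stopped_real :
  exists2 lam, 0 <= lam & lambda_stopped N a b = lam%:E.
Proof.
have L_ge0 : (0 <= lambda_stopped N a b)%E.
  by apply: le_ereal_inf_tmp => _ [f _ <-]; exact: Dform_ge0.
have one_stop : stopped_at N 1 (fun=> 1 : R) by [].
have s_gt0 : 0 < \sum_(k < 1) mu a b k.+1 * (1 : R) ^+ 2 + 1 ^+ 2 * mtail 1.
  rewrite big_ord1 mu1 expr1n !mul1r ltr_pwDl//.
  by apply: tail_ge0 => //; exact: mu_ge0.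
have := lambda_stopped_le N_ge1 one_stop (Dform_stopped N_ge1 one_stop)
  (mu_sq_stopped N_ge1 one_stop) s_gt0.
move=> /le_lt_trans/(_ (ltry _)) L_lty.
have LE : lambda_stopped N a b = (fine (lambda_stopped N a b))%:E.
  by rewrite fineK// ge0_fin_numE.
by exists (fine (lambda_stopped N a b)); rewrite // fine_ge0.
Qed.

End BirthDeath.

(** * Closing the two chains of inequalities *)

Theorem theorem4p1 (R : realType) (N : option nat) (a b : nat -> R)
  (N_ge1 : in_states N 1%N)
  (a_gt0 : forall i : nat, in_states N i -> (0 < a i)%R)
  (b_gt0 : forall i : nat, (0 < i)%N -> below N i -> (0 < b i)%R)
  (b_last : forall n : nat, N = Some n -> b n = 0%R)
  (mu_fin : \sum_(1 <= i <oo | in_states N i) (mu a b i)%:E < +oo) :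
  exists lambda0 : \bar R,
  [/\ [/\ lambda_ratio N a b = lambda0,
          lambda_norm N a b = lambda0 &
          lambda_stopped N a b = lambda0],
      (* difference form *)
      ereal_inf [set supE N (fun i => (tildeRop N a b p.1 p.2 i)%:E)
                | p in tV_1 N a b] = lambda0 /\
      lambda0 = ereal_sup [set infE N (fun i => (Rop a b v i)%:E)
                          | v in @V_1 R N],
      (* single summation form *)
      ereal_inf [set supE N (fun i => (Iop N a b f i)^-1)
                | f in @tF_I R N] = lambda0 /\
      lambda0 = ereal_sup [set infE N (fun i => (Iop N a b f i)^-1)
                          | f in @F_I R N],
      (* double summation form, lower bounds *)
      lambda0 = ereal_sup [set infE N (fun i => (IIop N a b f i)^-1)
                          | f in @F_II R N] /\
      lambda0 = ereal_sup [set infE N (fun i => (IIop N a b f i)^-1)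
                          | f in @F_I R N] &
      (* double summation form, upper bounds *)
      [/\ lambda0 = ereal_inf [set supE N (fun i => (IIop N a b f i)^-1)
                              | f in @tF_I R N],
          lambda0 = ereal_inf [set supE N (fun i => (IIop N a b f i)^-1)
                              | f in @tF_II R N] &
          lambda0 = ereal_inf [set supE N (fun i => (IIop N a b f i)^-1)
                              | f in @tF_II R N `|` tF_II' N a b]]].
Proof.
have [lam lam_ge0 lamE] := lambda_stopped_real a_gt0 b_gt0 mu_fin N_ge1.
set rat := lambda_ratio N a b; set nrm := lambda_norm N a b.
set R_sup := ereal_sup [set infE N (fun i => (Rop a b v i)%:E) | v in _].
set I_sup := ereal_sup [set infE N (fun i => (Iop N a b f i)^-1) | f in _].
set II_sup := ereal_sup [set infE N (fun i => (IIop N a b f i)^-1) | f in @F_I R N].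
set II_sup' := ereal_sup [set infE N (fun i => (IIop N a b f i)^-1) | f in @F_II R N].
set R_inf := ereal_inf [set supE N (fun i => (tildeRop N a b p.1 p.2 i)%:E) | p in _].
set I_inf := ereal_inf [set supE N (fun i => (Iop N a b f i)^-1) | f in _].
set II_inf := ereal_inf [set supE N (fun i => (IIop N a b f i)^-1) | f in @tF_I R N].
set II_inf' := ereal_inf [set supE N (fun i => (IIop N a b f i)^-1) | f in @tF_II R N].
set II_inf'' := ereal_inf [set supE N (fun i => (IIop N a b f i)^-1)
  | f in @tF_II R N `|` tF_II' N a b].
have c1 : lam%:E <= R_sup by apply: le_sup_V1; rewrite ?lamE.
have c2 : R_sup <= I_sup by exact: V_1_sup_le.
have c3 : I_sup <= II_sup by exact: F_I_sup_le.
have c4 : II_sup <= II_sup'.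
  by apply: ereal_sup_le => _ [f [f0 _] <-]; exists f.
have c5 : II_sup' <= rat by exact: F_II_sup_le.
have c6 : rat <= nrm by exact: lambda_ratio_le_norm.
have c7 : nrm <= lam%:E by rewrite -lamE; exact: lambda_norm_le_stopped.
have c8 : rat <= II_inf''.
  apply: le_ereal_inf_tmp => _ [f [fF|fF] <-]; first exact: lambda_ratio_le_tF_II.
  exact: lambda_ratio_le_tF_II'.
have c9 : II_inf'' <= II_inf'.
  by apply: ereal_inf_le_tmp => _ [f fF <-]; exists f => //; left.
have c10 : II_inf' <= II_inf.
  by apply: ereal_inf_le_tmp => _ [f fF <-]; exists f => //; exact: tF_I_tF_II.
have c11 : II_inf <= I_inf by exact: tF_I_II_le_I.
have c12 : I_inf <= R_inf by exact: tV_1_inf_ge.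
have c13 : R_inf <= lam%:E.
  (* The bad index exists only strictly above [lambda_stopped], so the value is approached from
     above; adding [e] also gives positivity when [lam] is 0. *)
  apply/lee_addgt0Pr => e e0; rewrite -EFinD; apply: tV_1_inf_le => //.
    by rewrite ltr_wpDl.
  by rewrite lamE lte_fin ltrDl.
have l2 := le_trans c1 c2; have l3 := le_trans l2 c3; have l4 := le_trans l3 c4.
have l5 := le_trans l4 c5; have l6 := le_trans l5 c6; have l8 := le_trans l5 c8.
have l9 := le_trans l8 c9; have l10 := le_trans l9 c10.
have l11 := le_trans l10 c11; have l12 := le_trans l11 c12.
have u6 := le_trans c6 c7; have u5 := le_trans c5 u6; have u4 := le_trans c4 u5.
have u3 := le_trans c3 u4; have u2 := le_trans c2 u3.
have u12 := le_trans c12 c13; have u11 := le_trans c11 u12.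
have u10 := le_trans c10 u11; have u9 := le_trans c9 u10.
have sandwich x : lam%:E <= x -> x <= lam%:E -> x = lam%:E.
  by move=> lx xl; apply/le_anti/andP.
exists lam%:E; split; [split=> //|split|split|split|split]; try exact: sandwich.
all: by apply/esym/sandwich.
Qed.
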